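(* Let $q\in(0,\infty)$. Put $$\rho(v):=\lambda\,|\tilde p(v)-v|\quad\text{and}\quad \gamma_q(v):=\frac{q+\mu(1-\tilde r(v))}{\rho(v)},\qquad v\in(0,1)\setminus\{\varphi\},$$ noting that $\tilde p(z)-z$ is $>0$ (resp. $<0$) for $z\in(0,\varphi)$ (resp. $z\in(\varphi,1)$), and that $\gamma_q(z)$ is $<0$ (resp. $>0$) for $z\in(0,\phi_q)\setminus\{\varphi\}$ (resp. $z\in(\phi_q,1)\setminus\{\varphi\}$). (i) Assume $\phi_q<\varphi$. Then $\Phi_q:\mathbb N_0\to(0,\infty)$, given by $$\Phi_q(x):=q\int_0^\varphi\frac{\exp\{-\int_{\phi_q}^v\gamma_q(w)\,\mathrm dw\}}{\rho(v)}\,v^x\,\mathrm dv,\qquad x\in\mathbb N_0,$$ belongs to $\mathcal I^q_0\setminus\{0\}$. Assume further (E). Then $\Psi_q:\mathbb N_0\to\mathbb R$, given by $$\Psi_q(x):=1-q\int_\varphi^1\frac{\exp\{-\int_v^1\gamma_q(w)\,\mathrm dw\}}{\rho(v)}\,v^x\,\mathrm dv,\qquad x\in\mathbb N_0,$$ is an element of $\mathcal I^q\setminus\mathcal I^q_0$. (ii) When $\phi_q=\varphi$, then $\Phi_q:\mathbb N_0\to(0,\infty)$, given by $\Phi_q(x):=\varphi^x$, $x\in\mathbb N_0$, belongs to $\mathcal I^q_0\setminus\{0\}$.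
   Context: Setting. $\mathbb N=\{1,2,\dots\}$, $\mathbb N_0=\mathbb N\cup\{0\}$. Fix $\lambda\in(0,\infty)$, $\mu\in[0,\infty)$, a probability distribution $p=(p_k)_{k\in\mathbb N_0}$ with $p_0>0$ and $p_1=0$, and a probability distribution $r=(r_k)_{k\in\{-1\}\cup\mathbb N}$ (put $r_0:=0$). Assume that $\mu r_k>0$ for some $k\in\mathbb N$ or $p_0<1$. Under probabilities $(\mathsf P_x)_{x\in\mathbb N_0}$, $X=(X_t)_{t\in[0,\infty)}$ is a minimal càdlàg continuous-time Markov chain with state space $\mathbb N_0$, started from $x$ under $\mathsf P_x$, with explosion time (lifetime) $\zeta$, $X$ being set equal to $\infty$ on $[\zeta,\infty)$, and with conservative generator matrix $(Q_{ij})$: $Q_{00}=0$ (state $0$ is absorbing) and, for $n\in\mathbb N$, $-Q_{nn}=\lambda n+\mu$, $Q_{n(n+m)}=p_{m+1}\lambda n+r_m\mu$ for $m\in\mathbb N\cup\{-1\}$. Condition (E): $\mathsf P_x(\zeta<\infty)>0$ for some (equivalently, all) $x\in\mathbb N$. Generating functions and roots. For $z\in(0,1]$, $\tilde p(z):=\sum_{k=0}^\infty p_kz^k$ and $\tilde r(z):=\sum_{k=-1}^\infty r_kz^k$. $\varphi$ is the smallest root of $\tilde p(z)=z$ in $z\in(0,1]$. If $\mu r_{-1}>0$, then $\phi_q$ is the unique root of $q=\mu(\tilde r(z)-1)$ in $z\in(0,1)$; if $\mu r_{-1}=0$, then $\phi_q:=0$. Spaces of harmonic functions. $\mathcal I^q$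 is the space of bounded $f:\mathbb N_0\to\mathbb R$ such that: the limit $f(\infty):=\lim_\infty f$ exists whenever (E) holds; and for all $x\in\mathbb N$, $$(q+\lambda x+\mu)f(x)=\lambda x\sum_{k=0}^\infty p_kf(x+k-1)+\mu\sum_{k=-1}^\infty r_kf(x+k).$$ $\mathcal I^q_0:=\{f\in\mathcal I^q:\lim_\infty f=0\}$. *)

(* Defs.v *)
From HB Require Import structures.
From mathcomp Require Import all_boot all_order all_algebra.
From mathcomp Require Import all_classical all_reals all_analysis.
From mathcomp Require Import measurable_realfun.
Set Implicit Arguments.
Unset Strict Implicit.
Unset Printing Implicit Defensive.
Import Order.TTheory GRing.Theory Num.Theory.
Import numFieldNormedType.Exports.
Local Open Scope classical_set_scope.
Local Open Scope ring_scope.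

(** * Minimal continuous-time Markov chains on nat *)

Definition rate (R : realType) (Q : nat -> nat -> R) (i : nat) : R := - Q i i.

Definition jump_matrix (R : realType) (Q : nat -> nat -> R) (i j : nat) : R :=
  if rate Q i == 0 then (i == j)%:R
  else if i == j then 0 else Q i j / rate Q i.

Definition jump_time (R : realType) (T : Type) (S : nat -> T -> \bar R)
    (n : nat) (w : T) : \bar R :=
  (\sum_(i < n) S i w)%E.

(** [X t w = None] encodes that X is at infinity (after explosion) at time t;
    only times t >= 0 matter.  Jump-chain/holding-time description: Y is the
    jump chain and S the sequence of holding times, with S i = +oo allowed
    (absorption).  The law of (Y, S) under P x says that Y is a Markov chain
    started at x with transition matrix [jump_matrix Q], and that, given Y, the
    S i are independent exponential times of rates [rate Q (Y i)] (rate 0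
    meaning S i = +oo almost surely). *)
Definition minimal_ctmc (R : realType) (d : measure_display)
    (T : measurableType d) (Q : nat -> nat -> R)
    (P : nat -> probability T R) (X : R -> T -> option nat) : Prop :=
  exists (Y : nat -> T -> nat) (S : nat -> T -> \bar R),
    [/\ (forall n, measurable_fun setT (Y n)) /\
        (forall n, measurable_fun setT (S n)),
        forall n w, (0 < S n w)%E,
        forall t n w, 0 <= t ->
          (jump_time S n w <= t%:E)%E -> (t%:E < jump_time S n.+1 w)%E ->
          X t w = Some (Y n w),
        forall t w, 0 <= t ->
          (forall n, (jump_time S n w <= t%:E)%E) -> X t w = None
      & forall (x n : nat) (y : nat -> nat) (t : nat -> R),
          (forall i, 0 <= t i) ->
          P x [set w | forall i, (i <= n)%N ->
                 Y i w = y i /\ ((t i)%:E < S i w)%E] =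
          ((y 0%N == x)%:R
           * (\prod_(i < n) jump_matrix Q (y i) (y i.+1))
           * \prod_(i < n.+1) expR (- (rate Q (y i) * t i)))%:E].

Definition lifetime (R : realType) (T : Type) (X : R -> T -> option nat)
    (w : T) : \bar R :=
  ereal_inf [set t%:E | t in [set t : R | 0 <= t /\ X t w = None]].

(** Condition (E). *)
Definition explosive (R : realType) (d : measure_display)
    (T : measurableType d) (P : nat -> probability T R)
    (X : R -> T -> option nat) : Prop :=
  exists x : nat,
    (0 < x)%N /\ (0 < P x [set w | (lifetime X w < +oo)%E])%E.

(** * The branching mechanism *)

Definition offspring_law (R : realType) (p : nat -> R) : Prop :=
  [/\ forall k, 0 <= p k, series p @ \oo --> (1 : R), 0 < p 0%N & p 1%N = 0].

(** r is indexed by int, but carried by {-1} and the positive integers; the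
    j-th term of the series is r_(j - 1). *)
Definition immigration_law (R : realType) (r : int -> R) : Prop :=
  [/\ forall k, 0 <= r k, forall k, (k < -1)%R -> r k = 0, r 0 = 0
    & series (fun j : nat => r (j%:Z - 1)) @ \oo --> (1 : R)].

Definition generator (R : realType) (lambda mu : R) (p : nat -> R)
    (r : int -> R) (i j : nat) : R :=
  if i == 0%N then 0
  else if j == i then - (lambda * i%:R + mu)
  else if (i <= j.+1)%N then
    p (j.+1 - i)%N * (lambda * i%:R) + r (j%:Z - i%:Z) * mu
  else 0.

Definition ptilde (R : realType) (p : nat -> R) (z : R) : R :=
  limn (series (fun k => p k * z ^+ k)).

Definition rtilde (R : realType) (r : int -> R) (z : R) : R :=
  r (-1) / z + limn (series (fun k : nat => r k%:Z * z ^+ k)).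

(** The smallest fixed point of [ptilde p] in (0, 1]. *)
Definition phi (R : realType) (p : nat -> R) : R :=
  let roots := [set z : R | 0 < z <= 1 /\ ptilde p z = z] in
  xget 1 [set z | roots z /\ forall z', roots z' -> z <= z'].

Definition phiq (R : realType) (mu : R) (r : int -> R) (q : R) : R :=
  if 0 < mu * r (-1) then
    xget 0 [set z : R | 0 < z < 1 /\ q = mu * (rtilde r z - 1)]
  else 0.

(** * Spaces of harmonic functions *)

(** E is the proposition "condition (E) holds".  In the equation x >= 1, so
    the natural subtraction is exact, also in the term f (x - 1) for k = -1. *)
Definition Iq (R : realType) (E : Prop) (lambda mu : R) (p : nat -> R)
    (r : int -> R) (q : R) : set (nat -> R) :=
  [set f | [/\ exists M : R, forall x, `|f x| <= M,
               E -> cvgn f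
             & forall x : nat, (0 < x)%N ->
                 (q + lambda * x%:R + mu) * f x =
                 lambda * x%:R * limn (series (fun k => p k * f (x + k - 1)%N))
                 + mu * (r (-1) * f (x - 1)%N
                       + limn (series (fun k : nat => r k%:Z * f (x + k)%N)))]].

Definition Iq0 (R : realType) (E : Prop) (lambda mu : R) (p : nat -> R)
    (r : int -> R) (q : R) : set (nat -> R) :=
  [set f | Iq E lambda mu p r q f /\ f @ \oo --> (0 : R)].

(** * The functions Phi_q and Psi_q *)

Definition rho (R : realType) (lambda : R) (p : nat -> R) (v : R) : R :=
  lambda * `|ptilde p v - v|.

Definition gammaq (R : realType) (lambda mu : R) (p : nat -> R) (r : int -> R)
    (q v : R) : R :=
  (q + mu * (1 - rtilde r v)) / rho lambda p v.

(** Oriented integral from a to b, also when b < a. *)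
Definition oriented_integral (R : realType) (g : R -> R) (a b : R) : \bar R :=
  if a <= b then (\int[lebesgue_measure]_(w in `]a, b[) (g w)%:E)%E
  else (- \int[lebesgue_measure]_(w in `]b, a[) (g w)%:E)%E.

(** All integrals are extended-real valued Lebesgue integrals of functions of
    constant sign, so that finiteness of Phi_q and Psi_q is meaningful. *)
Definition Phiq (R : realType) (lambda mu : R) (p : nat -> R) (r : int -> R)
    (q : R) (x : nat) : \bar R :=
  (q%:E * \int[lebesgue_measure]_(v in `]0%R, phi p[)
     (expeR (- oriented_integral (gammaq lambda mu p r q) (phiq mu r q) v)
      * ((rho lambda p v)^-1 * v ^+ x)%:E))%E.

Definition Psiq (R : realType) (lambda mu : R) (p : nat -> R) (r : int -> R)
    (q : R) (x : nat) : \bar R :=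
  (1 - q%:E * \int[lebesgue_measure]_(v in `]phi p, 1%R[)
     (expeR (- oriented_integral (gammaq lambda mu p r q) v 1)
      * ((rho lambda p v)^-1 * v ^+ x)%:E))%E.

(* Main.v *)
Require Import Defs.
From mathcomp Require Import all_boot all_order all_algebra.
From mathcomp Require Import all_classical all_reals all_analysis.
From mathcomp Require Import measurable_realfun.
From mathcomp Require Import ring lra.
Import Order.TTheory GRing.Theory Num.Theory.
Import numFieldNormedType.Exports.
Local Open Scope classical_set_scope.
Local Open Scope ring_scope.

(** Write [C(v) = q + mu (1 - rtilde(v))] for the numerator of [gammaq] and [Q] for the
    generator. Geometric sequences satisfy
      [(q - Q) v^x = C(v) v^x - lambda (ptilde(v) - v) (v^x)'],
    the prime being the derivative in [v]. On an interval where [ptilde - id] has the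
    constant sign [s] and [e] solves [e' = - s gammaq e], the mixture of the [v^x] with
    weights [e / rho] is therefore sent by [q - Q] to the integral of [- s (e(v) v^x)'],
    that is to boundary terms only ([resolvent_kernel]).

    On [(0, phi)] these boundary terms vanish: at [phi] because [rho(v)] is at most
    [lambda |v - phi|], so that the exponent of [e] diverges logarithmically
    ([expRN_primitive_at_left]), and at 0 because [e] is at most 1 and [x > 0]. So
    [Phiq] is harmonic, and it vanishes at infinity by dominated convergence. On
    [(phi, 1)] the boundary term is 0 at [phi] and 1 at 1 if the exponent of [e] is finite
    at 1; this is exactly what is needed to compensate [(q - Q) 1 = q], so that [Psiq] is
    harmonic, with limit 1 at infinity. When [phiq = phi] both [C] and [ptilde - id]
    vanish at [phi], and [phi^x] is harmonic by itself. The signs of [ptilde - id] and of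
    [C] come from one fact: chords that join the graph of a power series with
    nonnegative coefficients to its point above 1 get steeper from left to right
    ([ptilde_chord]).

    Condition (E) enters through the finiteness of the exponent at 1, and this is where
    the process is used ([explosive_exponent]). Suppose that [phi = 1] or that the
    exponent diverges at 1. The Laplace transforms [E_x exp(- q J_n)] of the jump times
    satisfy a recursion, obtained by discounting the independent exponential holding
    times one by one along each path ([laplace_path_mixed], [laplace_start]). By the
    comparison principle [jump_laplace_le] their limit is dominated by every function
    [F >= 0] with [Q F <= q F] and limit 1 at infinity. Such an [F] can be made arbitrarily
    small at a given [x]: take [1 - s v^x] with [v] near 1 if [phi = 1]
    ([small_superharmonic_phi1]), and otherwise 1 minus a multiple of the mixture above
    over an interval close to 1 on which the exponent varies a lot
    ([small_superharmonic_unbounded]). Hence the Laplace transforms tend to 0 and the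
    jump times are almost surely unbounded ([not_explosive_laplace]). *)

(** * Power series with summable nonnegative coefficients *)

Section PowerSeries.
Variables (R : realType) (c : nat -> R) (S : R).
Hypothesis c_ge0 : forall k, 0 <= c k.
Hypothesis cS : series c @ \oo --> S.

Lemma cvg_ptilde (v : R) : 0 <= v <= 1 ->
  series (fun k => c k * v ^+ k) @ \oo --> ptilde c v.
Proof.
move=> /andP[v0 v1]; apply: (@series_le_cvg _ _ c) => //.
- by move=> n; rewrite mulr_ge0// exprn_ge0.
- by move=> n; rewrite ler_piMr// exprn_ile1.
- by apply/cvg_ex; exists S.
Qed.

Lemma ptilde1 : ptilde c 1 = S.
Proof.
apply/cvg_lim => //; rewrite (_ : (fun k => _) = c)//.
by apply/funext => k; rewrite expr1n mulr1.
Qed.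

Lemma ptilde0 : ptilde c 0 = c 0%N.
Proof.
apply/cvg_lim => //; rewrite -cvg_shiftS.
apply: cvg_near_cst; apply: nearW => n.
rewrite seriesEnat/= big_nat_recl//= expr0 mulr1 big1 ?addr0// => i _.
by rewrite exprS mul0r mulr0.
Qed.

Lemma series_le_ptilde (v : R) n : 0 <= v <= 1 ->
  series (fun k => c k * v ^+ k) n <= ptilde c v.
Proof.
move=> v01; have vc := cvg_ptilde _ v01; have /andP[v0 v1] := v01.
apply: nondecreasing_cvgn_le; last by apply/cvg_ex; exists (ptilde c v).
apply/nondecreasing_seqP => k; rewrite !seriesEnat/= big_nat_recr//= lerDl.
by rewrite mulr_ge0// exprn_ge0.
Qed.

Lemma ptilde_ge0 (v : R) : 0 <= v <= 1 -> 0 <= ptilde c v.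
Proof.
by move=> /(series_le_ptilde _ 0); rewrite seriesEnat/= big_geq.
Qed.

Lemma ptilde_ge_c0 (v : R) : 0 <= v <= 1 -> c 0%N <= ptilde c v.
Proof.
by move=> /(series_le_ptilde _ 1); rewrite seriesEnat/= big_nat1 expr0 mulr1.
Qed.

Lemma le_ptilde (u v : R) : 0 <= u -> u <= v -> v <= 1 ->
  ptilde c u <= ptilde c v.
Proof.
move=> u0 uv v1.
have u01 : 0 <= u <= 1 by rewrite u0 (le_trans uv).
have v01 : 0 <= v <= 1 by rewrite v1 (le_trans u0).
have uc := cvg_ptilde _ u01; have vc := cvg_ptilde _ v01.
apply: ler_lim.
- by apply/cvg_ex; exists (ptilde c u).
- by apply/cvg_ex; exists (ptilde c v).
apply: nearW => n; rewrite !seriesEnat/=; apply: ler_sum => k _.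
by rewrite ler_wpM2l// lerXn2r ?nnegrE// (le_trans u0).
Qed.

Lemma chord_term (u v : R) k : 0 <= u -> u < v -> v < 1 ->
  (1 - u ^+ k) * (1 - v) <= (1 - v ^+ k) * (1 - u).
Proof.
move=> u0 uv v1.
have E x : 1 - x ^+ k = (1 - x) * \sum_(i < k) x ^+ i.
  by rewrite -opprB subrX1 -mulNr opprB.
rewrite !E mulrAC (mulrAC _ _ (1 - u)) [(1 - v) * (1 - u)]mulrC ler_pM2l; last first.
  by rewrite mulr_gt0// subr_gt0// (lt_trans uv).
by apply: ler_sum => i _; rewrite lerXn2r ?nnegrE ?(ltW uv)// (le_trans u0 (ltW uv)).
Qed.

Lemma chord_term_lt (u v : R) k : 0 <= u -> u < v -> v < 1 -> (1 < k)%N ->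
  (1 - u ^+ k) * (1 - v) < (1 - v ^+ k) * (1 - u).
Proof.
move=> u0 uv v1; case: k => [//|[//|k]] _.
have E x : 1 - x ^+ k.+2 = (1 - x) * \sum_(i < k.+2) x ^+ i.
  by rewrite -opprB subrX1 -mulNr opprB.
rewrite !E mulrAC (mulrAC _ _ (1 - u)) [(1 - v) * (1 - u)]mulrC ltr_pM2l; last first.
  by rewrite mulr_gt0// subr_gt0// (lt_trans uv).
rewrite !big_ord_recl/= !expr0 ltrD2l; apply: ltr_leD.
  by rewrite /bump/= !expr1.
by apply: ler_sum => i _; rewrite lerXn2r ?nnegrE ?(ltW uv)// (le_trans u0 (ltW uv)).
Qed.

(** Chords that end at the point above 1 get steeper as their left end increases,
    because the chord slope [(1 - v^k) / (1 - v)] of a monomial is the geometric sum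
    [1 + v + ... + v^(k-1)]. *)
Lemma chord_gap (u v : R) n : 0 <= u -> u < v -> v < 1 ->
  series (fun k => c k * ((1 - v ^+ k) * (1 - u) - (1 - u ^+ k) * (1 - v))) n
  <= (S - ptilde c v) * (1 - u) - (S - ptilde c u) * (1 - v).
Proof.
move=> u0 uv v1.
have v0 : 0 <= v := le_trans u0 (ltW uv).
have v01 : 0 <= v <= 1 by rewrite v0 ltW.
have u01 : 0 <= u <= 1 by rewrite u0 ltW// (lt_trans uv).
set w := fun k => _.
have wE : series w = fun n => (series c n - series (fun k => c k * v ^+ k) n) * (1 - u) -
    (series c n - series (fun k => c k * u ^+ k) n) * (1 - v).
  apply/funext => m; rewrite !seriesEnat/= -!sumrB !mulr_suml -sumrB.
  by apply: eq_bigr => k _; rewrite /w; ring.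
have wc : series w @ \oo --> (S - ptilde c v) * (1 - u) - (S - ptilde c u) * (1 - v).
  rewrite wE; apply: cvgB; apply: cvgMr_tmp; apply: cvgB => //; exact: cvg_ptilde.
rewrite -(cvg_lim _ wc)//; apply: nondecreasing_cvgn_le; last by apply/cvg_ex; eexists; exact: wc.
apply/nondecreasing_seqP => k; rewrite !seriesEnat/= big_nat_recr//= lerDl.
by rewrite mulr_ge0// subr_ge0 chord_term.
Qed.

Lemma ptilde_chord (u v : R) : 0 <= u -> u < v -> v < 1 ->
  (S - ptilde c u) * (1 - v) <= (S - ptilde c v) * (1 - u).
Proof.
move=> u0 uv v1; rewrite -subr_ge0.
by apply: le_trans (chord_gap _ _ 0 u0 uv v1); rewrite seriesEnat/= big_geq.
Qed.

Lemma ptilde_chord_lt (u v : R) k : 0 <= u -> u < v -> v < 1 ->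
  (1 < k)%N -> 0 < c k ->
  (S - ptilde c u) * (1 - v) < (S - ptilde c v) * (1 - u).
Proof.
move=> u0 uv v1 k1 ck; rewrite -subr_gt0.
apply: lt_le_trans (chord_gap _ _ k.+1 u0 uv v1).
rewrite seriesEnat/= big_nat_recr//= ltr_wpDl//.
  by apply: sumr_ge0 => i _; rewrite mulr_ge0// subr_ge0 chord_term.
by rewrite mulr_gt0// subr_gt0 chord_term_lt.
Qed.

(** The truncation error is largest at 1. *)
Lemma ptilde_tail (v : R) n : 0 <= v <= 1 ->
  0 <= ptilde c v - series (fun k => c k * v ^+ k) n <= S - series c n.
Proof.
move=> v01; have /andP[v0 v1] := v01.
rewrite subr_ge0 series_le_ptilde//=.
have h : series (fun k => c k * (1 - v ^+ k)) @ \oo --> S - ptilde c v.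
  rewrite (_ : series _ = fun n => series c n - series (fun k => c k * v ^+ k) n).
    by apply: cvgB => //; exact: cvg_ptilde.
  apply/funext => m; rewrite !seriesEnat/= -sumrB; apply: eq_bigr => k _; ring.
suff : series (fun k => c k * (1 - v ^+ k)) n <= S - ptilde c v.
  have -> : series (fun k => c k * (1 - v ^+ k)) n =
      series c n - series (fun k => c k * v ^+ k) n; last by move=> ?; lra.
  rewrite !seriesEnat/= -sumrB; apply: eq_bigr => k _; ring.
rewrite -(cvg_lim _ h)//; apply: nondecreasing_cvgn_le; last first.
  by apply/cvg_ex; eexists; exact: h.
apply/nondecreasing_seqP => k; rewrite !seriesEnat/= big_nat_recr//= lerDl.
by rewrite mulr_ge0// subr_ge0 exprn_ile1.
Qed.

(** A power series with summable nonnegative coefficients is a uniform limit of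
    polynomials on the unit interval; clamping the argument makes the limit a
    function continuous on the whole line. *)
Lemma ptilde_continuous : exists2 f : R -> R, continuous f &
  forall v, 0 <= v <= 1 -> f v = ptilde c v.
Proof.
pose cl (v : R) := Num.max 0 (Num.min v 1).
have clc : continuous cl.
  move=> x.
  have cmin : {for x, continuous ((@id R : R -> R^o) \min cst (1 : R))}.
    by apply: (@continuous_min R R (@id R) (cst (1 : R)) x); [exact: cvg_id|exact: cvg_cst].
  by have := @continuous_max R R (cst (0 : R)) _ x; apply=> //; exact: cvg_cst.
have cl01 v : 0 <= cl v <= 1.
  by rewrite /cl le_max lexx/= ge_max ler01/= ge_min lexx orbT.
exists (ptilde c \o cl); last first.
  by move=> v /andP[v0 v1]; rewrite /= /cl (min_idPl v1) (max_idPr v0).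
move=> x; apply/cvgrPdist_lt => e e0.
have e3 : 0 < e / 3 by rewrite divr_gt0.
have /cvgrPdist_lt/(_ _ e3) [N _ /(_ N (leqnn _)) SN] := cS.
pose f (v : R) := series (fun k => c k * cl v ^+ k) N.
have fe v : `|ptilde c (cl v) - f v| < e / 3.
  have /andP[h1 h2] := ptilde_tail _ N (cl01 v).
  rewrite ger0_norm//; apply: le_lt_trans (le_lt_trans (ler_norm (S - series c N)) SN).
  exact: h2.
have fc : f y @[y --> x] --> f x.
  rewrite /f /series /=; elim: N {SN f fe} => [|N IH].
    by rewrite big_geq//; under eq_fun do rewrite big_geq//; exact: cvg_cst.
  rewrite big_nat_recr//=; under eq_fun do rewrite big_nat_recr//=.
  apply: cvgD => //; apply: cvgMl_tmp.
  exact: (continuous_comp (clc x) (@exprn_continuous R N (cl x))).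
move/cvgrPdist_lt : fc => /(_ _ e3); apply: filterS => y /= fxy.
have := fe x; have := fe y; rewrite !ltr_norml => /andP[? ?] /andP[? ?].
by move: fxy; rewrite ltr_norml => /andP[? ?]; apply/andP; split; lra.
Qed.
End PowerSeries.

(** * Primitives on open intervals *)

Section Primitive.
Variables (R : realType) (a b : R).
Local Notation mu := (@lebesgue_measure R).

(** [primitive_oo] and [continuous_oo] quantify over reals with strict
    inequalities, which is the form in which linear arithmetic can use them. *)
Definition primitive_oo (G g : R -> R) : Prop :=
  forall v, a < v < b -> is_derive v 1 G (g v).

Definition continuous_oo (g : R -> R) : Prop :=
  forall v, a < v < b -> g x @[x --> v] --> g v.

Lemma primitive_oo_continuous (G g : R -> R) :
  primitive_oo G g -> continuous_oo G.
Proof.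
move=> dG v vab; have [dv _] := dG v vab.
by apply: differentiable_continuous; apply/derivable1_diffP.
Qed.

Lemma within_continuous_oo (g : R -> R) (u v : R) : continuous_oo g ->
  a < u -> v < b -> {within `[u, v], continuous g}.
Proof.
move=> cg au vb; apply: continuous_in_subspaceT => x /set_mem/=.
by rewrite in_itv/= => /andP[ux xv]; apply: cg; rewrite (lt_le_trans au)//= (le_lt_trans xv).
Qed.

Lemma MVT_oo (G g : R -> R) (u v : R) : primitive_oo G g ->
  a < u -> u <= v -> v < b -> exists2 c, u <= c <= v & G v - G u = g c * (v - u).
Proof.
move=> dG au uv vb; have [|c|c] := @MVT_segment R G g u v uv.
- by move=> x /[!in_itv]/= /andP[ux xv]; apply: dG; rewrite (lt_trans au)//= (lt_trans xv).
- by apply: within_continuous_oo => //; exact: primitive_oo_continuous dG.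
- by rewrite in_itv/= => cuv E; exists c.
Qed.

Lemma primitive_oo_le (G g : R -> R) (u v : R) : primitive_oo G g ->
  (forall w, a < w < b -> 0 <= g w) -> a < u -> u <= v -> v < b -> G u <= G v.
Proof.
move=> dG g0 au uv vb; have [c /andP[uc cv] E] := MVT_oo _ _ _ _ dG au uv vb.
rewrite -subr_ge0 E mulr_ge0 ?subr_ge0// g0// (lt_le_trans au)//=.
by rewrite (le_lt_trans cv).
Qed.

Lemma measurable_oo (g : R -> R) : continuous_oo g -> measurable_fun `]a, b[ g.
Proof.
move=> cg; apply: open_continuous_measurable_fun; first exact: interval_open.
by move=> x /set_mem/=; rewrite in_itv/=; exact: cg.
Qed.

Lemma integral_primitive (G g : R -> R) (u v : R) : primitive_oo G g ->
  continuous_oo g -> a < u -> u <= v -> v < b ->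
  (\int[mu]_(x in `[u, v]) (g x)%:E = (G v - G u)%:E)%E.
Proof.
move=> dG cg au; rewrite le_eqVlt => /predU1P[<- ub|uv vb].
  by rewrite set_itv1 integral_set1 subrr.
have cG := primitive_oo_continuous _ _ dG.
rewrite (@continuous_FTC2 _ g G)// ?EFinB//.
- exact: within_continuous_oo.
- split.
  + move=> x /[!in_itv]/= /andP[ux xv].
    by have [] := dG x; rewrite ?(lt_trans au)//= (lt_trans xv).
  + by apply: cvg_at_right_filter; apply: cG; rewrite au (lt_trans uv).
  + by apply: cvg_at_left_filter; apply: cG; rewrite vb (lt_trans au).
- move=> x /[!in_itv]/= /andP[ux xv].
  have xab : a < x < b by rewrite (lt_trans au)//= (lt_trans xv).
  by rewrite derive1E; have [_ ->] := dG x xab.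
Qed.

Lemma integral_primitive_oo (G g : R -> R) (u v : R) : primitive_oo G g ->
  continuous_oo g -> a < u -> u <= v -> v < b ->
  (\int[mu]_(x in `]u, v[) (g x)%:E = (G v - G u)%:E)%E.
Proof.
move=> dG cg au uv vb; rewrite -(integral_primitive _ _ _ _ dG cg au uv vb).
have mg : measurable_fun `]u, v[ (EFin \o g).
  apply/measurable_EFinP.
  apply: measurable_funS (measurable_oo _ cg) => //.
  by apply: subset_itv; rewrite bnd_simp// ltW.
move: uv; rewrite le_eqVlt => /predU1P[<-|uv].
  by rewrite set_itvoo0// integral_set0 set_itv1 integral_set1.
rewrite integral_itv_bndo_bndc// integral_itv_obnd_cbnd//.
apply/measurable_EFinP.
apply: measurable_funS (measurable_oo _ cg) => //.
by apply: subset_itv; rewrite bnd_simp// ltW.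
Qed.

(** Gluing the two one-sided integrals from the midpoint. *)
Lemma primitive_ex (g : R -> R) : a < b -> continuous_oo g ->
  exists G, primitive_oo G g.
Proof.
move=> ab cg; pose c := (a + b) / 2.
have ac : a < c by rewrite /c; lra.
have cb : c < b by rewrite /c; lra.
have int u v : a < u -> v < b -> mu.-integrable `[u, v] (EFin \o g).
  move=> au vb; apply: continuous_compact_integrable; first exact: segment_compact.
  exact: within_continuous_oo.
pose G v := if c <= v then \int[mu]_(x in `[c, v]) g x
            else - \int[mu]_(x in `[v, c]) g x.
exists G => v /andP[av vb].
pose u := (a + Num.min v c) / 2; pose w := (b + Num.max v c) / 2.
have [au uv uc] : [/\ a < u, u < v & u < c] by rewrite /u; case: (lerP v c) => ?; split; lra.
have [vw cw wb] : [/\ v < w, c < w & w < b] by rewrite /w; case: (lerP v c) => ?; split; lra.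
pose F x := \int[mu]_(t in `[u, x]) g t.
have [dF dFE] := @continuous_FTC1_closed R g u v w vw (int _ _ au wb) uv (cg _ (introT andP (conj av vb))).
have hF : is_derive v 1 (F + cst (- F c)) (g v).
  rewrite -[g v]addr0; apply: is_deriveD.
  by apply: DeriveDef; [exact: dF|rewrite -derive1E; exact: dFE].
apply: near_eq_is_derive hF.
have split3 x y : u < x -> x <= y -> y < w ->
    F y - F x = \int[mu]_(t in `[x, y]) g t.
  move=> ux xy yw.
  have iuy : mu.-integrable `[u, y] (EFin \o g) by apply: int => //; exact: lt_trans wb.
  rewrite /F (Rintegral_itvB iuy) ?bnd_simp//; last exact: ltW.
  rewrite Rintegral_itv_obnd_cbnd//; apply: integrableS iuy => //.
  by apply: subset_itvr; rewrite bnd_simp ltW.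
near=> x.
have [ux xw] : u < x /\ x < w by split; near: x; [exact: lt_nbhsr|exact: lt_nbhsl].
rewrite /G /cst !fctE; case: leP => cx.
  by rewrite -split3.
by rewrite -split3 ?opprB// ltW.
Unshelve. all: by end_near. Qed.
End Primitive.

Lemma primitive_oo_sub (R : realType) (a b a' b' : R) (G g : R -> R) : a <= a' -> b' <= b ->
  primitive_oo R a b G g -> primitive_oo R a' b' G g.
Proof.
move=> aa bb h v /andP[av vb]; apply: h.
by rewrite (le_lt_trans aa)//= (lt_le_trans vb).
Qed.

Lemma continuous_oo_sub (R : realType) (a b a' b' : R) (g : R -> R) : a <= a' -> b' <= b ->
  continuous_oo R a b g -> continuous_oo R a' b' g.
Proof.
move=> aa bb h v /andP[av vb]; apply: h.
by rewrite (le_lt_trans aa)//= (lt_le_trans vb).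
Qed.

Lemma primitive_oo_addC (R : realType) (a b k : R) (G g : R -> R) :
  primitive_oo R a b G g -> primitive_oo R a b (fun v => G v - k) g.
Proof.
move=> h v vab; have hv := h v vab.
have := is_deriveB hv (is_derive_cst k v (1 : R)); rewrite subr0; exact.
Qed.

(** * Improper integrals and logarithmic divergence *)

Section ImproperIntegral.
Variables (R : realType) (a b : R).
Hypothesis ab : a < b.
Local Notation mu := (@lebesgue_measure R).

Let lo n : R := a + (b - a) / n.+2%:R.
Let hi n : R := b - (b - a) / n.+2%:R.

Let lo_gt n : a < lo n.
Proof. by rewrite ltrDl divr_gt0// subr_gt0. Qed.

Let hi_lt n : hi n < b.
Proof. by rewrite ltrBlDr ltrDl divr_gt0// subr_gt0. Qed.

Let lo_hi n : lo n <= hi n.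
Proof.
have h0 : 0 <= (b - a) / n.+2%:R by rewrite divr_ge0// subr_ge0 ltW.
have E : (b - a) / n.+2%:R * n.+2%:R = b - a by rewrite divfK.
have : (b - a) / n.+2%:R * 2 <= (b - a) / n.+2%:R * n.+2%:R.
  by rewrite ler_wpM2l// ler_nat.
by rewrite E /lo /hi; move: (_ / _) => h; lra.
Qed.

Let h_cvg : (b - a) / n.+2%:R @[n --> \oo] --> (0 : R).
Proof.
rewrite -(mulr0 (b - a)); apply: cvgMl_tmp.
have := @cvg_harmonic R; rewrite -(cvg_shiftS (@harmonic R : nat -> R^o)); exact.
Qed.

Let lo_cvg : lo n @[n --> \oo] --> a.
Proof. by rewrite -[X in _ --> X]addr0; apply: cvgD h_cvg; exact: cvg_cst. Qed.

Let hi_cvg : hi n @[n --> \oo] --> b.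
Proof. by rewrite -[X in _ --> X]subr0; apply: cvgB h_cvg; exact: cvg_cst. Qed.

Let exhaust : `]a, b[%classic = \bigcup_n `[lo n, hi n]%classic.
Proof.
apply/seteqP; split=> [x|x [n _]] /=; rewrite in_itv/= => /andP[ax xb]; last first.
  by rewrite in_itv/= (lt_le_trans (lo_gt n) ax) (le_lt_trans xb (hi_lt n)).
near \oo => n; exists n => //=; rewrite in_itv/=; apply/andP; split; near: n.
- by apply: cvgr_le ax; exact: lo_cvg.
- by apply: cvgr_ge xb; exact: hi_cvg.
Unshelve. all: by end_near. Qed.

Let exhaust_nd : nondecreasing_seq (fun n => `[lo n, hi n]%classic).
Proof.
apply/nondecreasing_seqP => n; apply/subsetPset; apply: subset_itv; rewrite bnd_simp.
- by rewrite lerD2l ler_pM2l ?subr_gt0// lef_pV2 ?posrE// ler_nat.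
- by rewrite lerD2l lerN2 ler_pM2l ?subr_gt0// lef_pV2 ?posrE// ler_nat.
Qed.

Let sub_ab n : `[lo n, hi n] `<=` `]a, b[.
Proof. by rewrite exhaust => x ?; exists n. Qed.

Let cvg_exhaust (f : R -> \bar R) : mu.-integrable `]a, b[ f ->
  (\int[mu]_(x in `[lo n, hi n]) f x @[n --> \oo] --> \int[mu]_(x in `]a, b[) f x)%E.
Proof.
move=> intf; have mf : measurable_fun `]a, b[ f by exact: measurable_int intf.
rewrite integralE.
under eq_fun do rewrite integralE.
have mS n : measurable_fun `[lo n, hi n] f.
  by apply: measurable_funS mf => //; exact: sub_ab.
apply: cvgeB.
- exact: integrable_add_def.
- rewrite exhaust; apply: ge0_nondecreasing_set_cvg_integral => //.
  by move=> n; exact: (measurable_funepos (mS n)).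
- rewrite exhaust; apply: ge0_nondecreasing_set_cvg_integral => //.
  by move=> n; exact: (measurable_funeneg (mS n)).
Qed.

Section limits.
Variables (G g : R -> R) (la lb : R).
Hypotheses (dG : primitive_oo R a b G g) (cg : continuous_oo R a b g).
Hypotheses (Ga : G x @[x --> a^'+] --> la) (Gb : G x @[x --> b^'-] --> lb).

Let cvg_bound :
  (\int[mu]_(x in `[lo n, hi n]) (g x)%:E @[n --> \oo] --> (lb - la)%:E)%E.
Proof.
under eq_fun do rewrite (integral_primitive _ _ _ _ _ _ _ dG)//.
apply: cvg_EFin; first exact: nearW.
apply: cvgB.
- by move/cvg_at_leftP : Gb; apply; split.
- by move/cvg_at_rightP : Ga; apply; split.
Qed.

(** The fundamental theorem of calculus on a bounded open interval, for an
    integrand that may be singular at the end points. *)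
Lemma integral_primitive_cvg : mu.-integrable `]a, b[ (EFin \o g) ->
  (\int[mu]_(x in `]a, b[) (g x)%:E = (lb - la)%:E)%E.
Proof.
move=> ig; apply: cvg_unique cvg_bound => //.
exact: (cvg_exhaust (EFin \o g)).
Qed.

Lemma ge0_integral_primitive_cvg : (forall x, a < x < b -> 0 <= g x) ->
  (\int[mu]_(x in `]a, b[) (g x)%:E = (lb - la)%:E)%E.
Proof.
move=> g0; apply: cvg_unique cvg_bound => //.
rewrite exhaust; apply: ge0_nondecreasing_set_cvg_integral => //.
- move=> n; apply/measurable_EFinP; apply: measurable_funS (measurable_oo _ _ _ _ cg) => //.
- by move=> n x /sub_ab/=; rewrite in_itv/= lee_fin; exact: g0.
Qed.
End limits.
End ImproperIntegral.

Section LogDivergence.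
Variable R : realType.

Lemma expR_kln_cvg0 (a K k : R) : 0 < k ->
  K * expR (k * ln (x - a)) @[x --> a^'+] --> 0.
Proof.
move=> k0; rewrite -(mulr0 K); apply: cvgMl_tmp.
apply/cvgrPdist_lt => e e0; near=> x.
have x0 : 0 < x - a by rewrite subr_gt0; near: x; exact: nbhs_right_gt.
rewrite sub0r normrN gtr0_norm ?expR_gt0// -[ltRHS]lnK ?posrE// ltr_expR.
rewrite mulrC -ltr_pdivlMr// -[ltRHS]expRK ltr_ln ?posrE ?expR_gt0//.
rewrite ltrBlDl; near: x; apply: nbhs_right_lt; rewrite ltrDl; exact: expR_gt0.
Unshelve. all: by end_near. Qed.

(** A primitive of a function larger than [k / (x - a)] behaves at best like
    [k ln (x - a)] at [a], hence its exponential vanishes there. *)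
Lemma expR_primitive_at_right (a b k : R) (G g : R -> R) : a < b -> 0 < k ->
  primitive_oo R a b G g -> (forall x, a < x < b -> k / (x - a) <= g x) ->
  expR (G x) @[x --> a^'+] --> 0.
Proof.
move=> ab k0 dG gk; pose m := (a + b) / 2.
have [am mb] : a < m /\ m < b by rewrite /m; split; lra.
pose H x := G x - k * ln (x - a).
have dH : primitive_oo R a b H (fun x => g x - k / (x - a)).
  move=> x /andP[ax xb].
  have dln : is_derive x 1 (fun y => ln (y - a)) (x - a)^-1.
    have xa : 0 < x - a by rewrite subr_gt0.
    have dxa : is_derive x 1 (fun y => y - a) 1 := is_derive_shift x 1 (- a).
    by have := @is_derive1_comp R (@ln R) _ x _ _ (is_derive1_ln xa) dxa; rewrite mulr1.
  have dGx : is_derive x 1 G (g x) by apply: dG; rewrite ax xb.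
  exact: is_deriveB.
have E x : a < x -> x <= m -> expR (G x) <= expR (H m) * expR (k * ln (x - a)).
  move=> ax xm; rewrite -expRD ler_expR.
  have : H x <= H m.
    apply: (primitive_oo_le _ _ _ _ _ _ _ dH) => // w wab.
    by rewrite subr_ge0 gk.
  by rewrite /H; lra.
have lim := expR_kln_cvg0 a (expR (H m)) k k0.
apply: (squeeze_cvgr _ (@cvg_cst _ (0 : R) _ _ _) lim).
near=> x; rewrite expR_ge0/= E//.
by near: x; apply: nbhs_right_le.
Unshelve. all: by end_near. Qed.

Lemma expRN_primitive_at_left (a b k : R) (G g : R -> R) : a < b -> 0 < k ->
  primitive_oo R a b G g -> (forall x, a < x < b -> k / (b - x) <= g x) ->
  expR (- G x) @[x --> b^'-] --> 0.
Proof.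
move=> ab k0 dG gk; apply/cvg_at_leftNP => /=.
have := @expR_primitive_at_right (- b) (- a) k (fun x => - G (- x)) (fun x => g (- x)).
apply => //; first by rewrite ltrN2.
- move=> x xab; have xab' : a < - x < b by apply/andP; split; lra.
  have dN : is_derive x (1 : R) -%R (-1) by exact: is_deriveNid.
  have := @is_derive1_comp R G -%R x _ _ (dG _ xab') dN.
  move=> /is_deriveN; rewrite mulrN1 opprK; exact.
- move=> x xab; have xab' : a < - x < b by apply/andP; split; lra.
  by have := gk _ xab'; rewrite !opprK addrC.
Qed.
End LogDivergence.

(** * The branching mechanism *)

Section Offspring.
Variables (R : realType) (lambda : R) (p : nat -> R).
Hypotheses (hlambda : 0 < lambda) (hp : offspring_law p).

Let p_ge0 : forall k, 0 <= p k. Proof. by case: hp. Qed.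
Let p_sum : series p @ \oo --> (1 : R). Proof. by case: hp. Qed.
Let p0_gt0 : 0 < p 0%N. Proof. by case: hp. Qed.

(** Otherwise [ptilde p] is constant, as [p 1 = 0], and equal to its value 1 at 1. *)
Lemma root_lt1_branching (z : R) : z < 1 -> ptilde p z = z ->
  exists2 k, (1 < k)%N & 0 < p k.
Proof.
move=> z1 Pz; apply: contrapT => noex.
have pk k : (1 < k)%N -> p k = 0.
  move=> k1; apply/eqP; rewrite eq_le p_ge0 andbT leNgt; apply/negP => pk0.
  by apply: noex; exists k.
have Es (v : R) : ptilde p v = p 0%N.
  apply/cvg_lim => //; rewrite -cvg_shiftS; apply: cvg_near_cst; apply: nearW => n.
  rewrite seriesEnat/= big_nat_recl//= expr0 mulr1 big1 ?addr0// => i _.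
  have [_ _ _ p1] := hp.
  by case: i => [|i]; [rewrite p1 mul0r|rewrite pk// mul0r].
by have := ptilde1 _ _ _ p_sum; rewrite Es -(Es z) Pz => z1E; rewrite z1E ltxx in z1.
Qed.

(** Two fixed points below 1 would be the left ends of two chords to (1, 1) of the
    same slope 1, which [ptilde_chord_lt] excludes; so a smallest fixed point
    exists. *)
Lemma phi_spec : [/\ 0 < phi p, phi p <= 1, ptilde p (phi p) = phi p
  & forall z, 0 < z <= 1 -> ptilde p z = z -> phi p <= z].
Proof.
set rt := [set z : R | 0 < z <= 1 /\ ptilde p z = z].
have : exists z, rt z /\ forall z', rt z' -> z <= z'.
  have [[z [/andP[z0 z1] Pz]]|nor] := pselect (exists z, 0 < z < 1 /\ ptilde p z = z).
    exists z; split; first by split=> //; rewrite z0 ltW.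
    move=> y [/andP[y0 y1] Py]; rewrite leNgt; apply/negP => yz.
    have [k k1 pk] := root_lt1_branching _ z1 Pz.
    have := ptilde_chord_lt _ _ _ p_ge0 p_sum _ _ _ (ltW y0) yz z1 k1 pk.
    by rewrite Py Pz mulrC ltxx.
  exists 1; split; first by split; rewrite ?ltr01 ?lexx// (ptilde1 _ _ _ p_sum).
  move=> y [/andP[y0 y1] Py]; rewrite leNgt; apply/negP => y1'.
  by apply: nor; exists y; rewrite y0 y1'.
move=> /(xgetPex 1); rewrite -/(phi p) => -[[/andP[? ?] ?] h].
by split=> // z z01 Pz; apply: h.
Qed.

(** Below [phi < 1] chords to (1, 1) have slope less than 1; when [phi = 1] a change
    of sign would produce a fixed point, because [ptilde p 0 = p 0 > 0]. *)
Lemma ptilde_gt_id (z : R) : 0 < z < phi p -> 0 < ptilde p z - z.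
Proof.
have [phi0 phi1 Pphi phimin] := phi_spec.
move=> /andP[z0 zphi]; have z1 : z < 1 := lt_le_trans zphi phi1.
move: phi1; rewrite le_eqVlt => /predU1P[phi1|phi1].
  have [f fc fE] := ptilde_continuous _ _ _ p_ge0 p_sum.
  rewrite ltNge; apply/negP => Pz.
  have [||c] := @IVT R (fun v => f v - v) 0 z 0 (ltW z0).
  - apply: continuous_subspaceT => v; apply: cvgB; first exact: fc.
    exact: cvg_id.
  - rewrite !fE ?lexx ?ler01// ?(ltW z0) ?(ltW z1)// subr0 (ptilde0 _ p).
    by rewrite ge_min Pz orbT le_max (ltW p0_gt0).
  rewrite in_itv/= => /andP[c0 cz].
  have c01 : 0 <= c <= 1 by rewrite c0 (le_trans cz (ltW z1)).
  move/eqP; rewrite fE// subr_eq0 => /eqP Pc.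
  have cgt0 : 0 < c by rewrite -Pc (lt_le_trans p0_gt0)// (ptilde_ge_c0 _ _ _ p_ge0 p_sum).
  have := phimin c _ Pc; rewrite cgt0 (andP c01).2 => /(_ isT).
  by rewrite leNgt (le_lt_trans cz).
have [k k1 pk] := root_lt1_branching _ phi1 Pphi.
have := ptilde_chord_lt _ _ _ p_ge0 p_sum _ _ _ (ltW z0) zphi phi1 k1 pk.
by rewrite Pphi mulrC ltr_pM2l ?subr_gt0//; lra.
Qed.

Lemma ptilde_lt_id (z : R) : phi p < z < 1 -> ptilde p z - z < 0.
Proof.
have [phi0 phi1 Pphi phimin] := phi_spec.
move=> /andP[phiz z1]; have phi1' := lt_trans phiz z1.
have [k k1 pk] := root_lt1_branching _ phi1' Pphi.
have := ptilde_chord_lt _ _ _ p_ge0 p_sum _ _ _ (ltW phi0) phiz z1 k1 pk.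
by rewrite Pphi mulrC ltr_pM2r ?subr_gt0//; lra.
Qed.

Lemma rho_lt_phi (z : R) : 0 < z < phi p -> rho lambda p z = lambda * (ptilde p z - z).
Proof. by move=> /ptilde_gt_id h; rewrite /rho gtr0_norm. Qed.

Lemma rho_gt_phi (z : R) : phi p < z < 1 -> rho lambda p z = - (lambda * (ptilde p z - z)).
Proof. by move=> /ptilde_lt_id h; rewrite /rho ltr0_norm// mulrN. Qed.

Lemma rho_gt0 (z : R) : 0 < z < 1 -> z != phi p -> 0 < rho lambda p z.
Proof.
move=> /andP[z0 z1]; rewrite neq_lt => /orP[zphi|zphi].
  by rewrite rho_lt_phi ?mulr_gt0// ?ptilde_gt_id// z0.
by rewrite rho_gt_phi ?oppr_gt0 ?pmulr_rlt0// ?ptilde_lt_id// z1 andbT.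
Qed.

(** Monotonicity of the generating function bounds [rho] by the distance to its
    zero, whatever the moments of the offspring law. *)
Lemma rho_le_left (z : R) : 0 < z < phi p -> rho lambda p z <= lambda * (phi p - z).
Proof.
have [phi0 phi1 Pphi phimin] := phi_spec.
move=> zphi; have /andP[z0 zp] := zphi; rewrite rho_lt_phi// ler_pM2l// lerD2r -[leRHS]Pphi.
by apply: (le_ptilde _ _ _ p_ge0 p_sum) => //; exact: ltW.
Qed.

Lemma rho_le_right (z : R) : phi p < z < 1 -> rho lambda p z <= lambda * (z - phi p).
Proof.
have [phi0 phi1 Pphi phimin] := phi_spec.
move=> zphi; have /andP[zp z1] := zphi; rewrite rho_gt_phi// -mulrN ler_pM2l// opprB.
rewrite lerD2l lerN2 -[leLHS]Pphi.
by apply: (le_ptilde _ _ _ p_ge0 p_sum) => //; exact: ltW.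
Qed.

(** On this side [rho (v) / (1 - v)] is decreasing, by monotonicity of chord slopes. *)
Lemma rho_decr (u v : R) : 0 < u -> u <= v -> v < phi p -> rho lambda p v <= rho lambda p u.
Proof.
have [phi0 phi1 Pphi phimin] := phi_spec.
move=> u0; rewrite le_eqVlt => /predU1P[->//|uv] vphi.
have v0 := lt_trans u0 uv; have v1 := lt_le_trans vphi phi1.
rewrite !rho_lt_phi ?u0 ?v0 ?vphi ?(lt_trans uv)// ler_pM2l//.
have := ptilde_chord _ _ _ p_ge0 p_sum _ _ (ltW u0) uv v1.
have := ptilde_gt_id v; rewrite v0 vphi => /(_ isT) Av.
have u1 := lt_trans uv v1.
by move: (ptilde p u) (ptilde p v) Av => Pu Pv Av; nra.
Qed.

Lemma rho_continuous (v : R) : 0 < v < 1 -> rho lambda p x @[x --> v] --> rho lambda p v.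
Proof.
move=> /andP[v0 v1].
have [f fc fE] := ptilde_continuous _ _ _ p_ge0 p_sum.
have : lambda * `|f x - x| @[x --> v] --> lambda * `|f v - v|.
  apply: cvgMl_tmp; apply: cvg_norm; apply: cvgB; first exact: fc.
  exact: cvg_id.
rewrite fE ?(ltW v0) ?(ltW v1)//; apply: cvg_trans; apply: near_eq_cvg.
near=> x; rewrite /rho fE//; apply/andP; split; apply: ltW; near: x.
- exact: lt_nbhsr.
- exact: lt_nbhsl.
Unshelve. all: by end_near. Qed.

End Offspring.

(** * The immigration mechanism *)

Section Immigration.
Variables (R : realType) (mu : R) (r : int -> R) (q : R).
Hypotheses (hmu : 0 <= mu) (hr : immigration_law r) (hq : 0 < q).

(** The discounted immigration mechanism, that is the numerator of [gammaq]. *)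
Definition immigration_rate (v : R) : R := q + mu * (1 - rtilde r v).

Let r_ge0 k : 0 <= r k. Proof. by case: hr. Qed.
Let rn_ge0 (k : nat) : 0 <= r k%:Z. Proof. exact: r_ge0. Qed.

Lemma immigration_sum : series (fun k : nat => r k%:Z) @ \oo --> 1 - r (-1).
Proof.
have [_ _ _ h] := hr.
have : series (fun j : nat => r (j%:Z - 1)) n.+1 @[n --> \oo] --> (1 : R).
  by rewrite (cvg_shiftS (series (fun j : nat => r (j%:Z - 1)))).
move=> /(fun h => cvgB h (@cvg_cst _ (r (-1)) _ _ _)); apply: cvg_trans.
apply: near_eq_cvg; apply: nearW => n /=.
change (series (fun j : nat => r (j%:Z - 1)) n.+1 - r (-1) = series (fun k : nat => r k%:Z) n).
rewrite !seriesEnat/= big_nat_recl//= sub0r addrC addKr.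
by apply: eq_bigr => i _; congr r; rewrite -addn1 PoszD addrK.
Qed.

Let Rs := ptilde (fun k : nat => r k%:Z).

Let rtildeE v : rtilde r v = r (-1) / v + Rs v. Proof. by []. Qed.

Let Rs_ge0 v : 0 <= v <= 1 -> 0 <= Rs v.
Proof. exact: (ptilde_ge0 _ _ _ rn_ge0 immigration_sum). Qed.

Let Rs_le v : 0 <= v <= 1 -> Rs v <= 1 - r (-1).
Proof.
move=> /andP[v0 v1]; rewrite -(ptilde1 _ _ _ immigration_sum).
exact: (le_ptilde _ _ _ rn_ge0 immigration_sum).
Qed.

Lemma mul_rtilde_bounds (v : R) : 0 < v < 1 -> 0 <= v * rtilde r v <= 1.
Proof.
move=> /andP[v0 v1]; have v01 : 0 <= v <= 1 by rewrite !ltW.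
have -> : v * rtilde r v = r (-1) + v * Rs v.
  by rewrite rtildeE mulrDr mulrCA divff ?gt_eqF// mulr1.
have R0 := Rs_ge0 _ v01; have := Rs_le _ v01; have := r_ge0 (-1).
have : 0 <= v * Rs v by rewrite mulr_ge0// ltW.
have : v * Rs v <= Rs v by rewrite ler_piMl// ltW.
by move: (v * Rs v) (Rs v) (r (-1)) => ? ? ? ? ? ? ?; apply/andP; split; lra.
Qed.

Lemma rtilde_ge0 (v : R) : 0 < v < 1 -> 0 <= rtilde r v.
Proof.
move=> v01; have /andP[h _] := mul_rtilde_bounds _ v01.
by move: h; rewrite pmulr_rge0//; case/andP: v01.
Qed.

Lemma immigration_rate_le (v : R) : 0 < v < 1 -> immigration_rate v <= q + mu.
Proof.
move=> /rtilde_ge0 h; rewrite lerD2l ler_piMr//; lra.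
Qed.

(** Divided by [1 - v] the discounted immigration mechanism increases: this is
    the monotonicity of chord slopes, together with that of [q / (1 - v)] and of
    [- 1 / v]. *)
Lemma immigration_rate_chord (u v : R) : 0 < u -> u < v -> v < 1 ->
  immigration_rate u * (1 - v) < immigration_rate v * (1 - u).
Proof.
move=> u0 uv v1; rewrite /immigration_rate !rtildeE.
have v0 := lt_trans u0 uv; have u1 := lt_trans uv v1.
have := ptilde_chord _ _ _ rn_ge0 immigration_sum _ _ (ltW u0) uv v1.
rewrite -/Rs; move: (Rs u) (Rs v) => Ru Rv h.
have uvV : v^-1 <= u^-1 by rewrite lef_pV2// ltW.
have E w : w != 0 -> r (-1) / w = r (-1) + r (-1) * w^-1 * (1 - w).
  by move=> w0; field.
rewrite (E u) ?gt_eqF// (E v) ?gt_eqF//.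
have hx : 0 <= r (-1) * (u^-1 - v^-1) * ((1 - u) * (1 - v)).
  by rewrite !mulr_ge0// subr_ge0// ltW.
have hh : 0 <= mu * (((1 - r (-1) - Rv) * (1 - u) - (1 - r (-1) - Ru) * (1 - v))
    + r (-1) * (u^-1 - v^-1) * ((1 - u) * (1 - v))).
  by rewrite mulr_ge0// addr_ge0// subr_ge0.
have hqq : 0 < q * (v - u) by rewrite mulr_gt0// subr_gt0.
rewrite -subr_gt0.
set L := (X in 0 < X).
have -> : L = q * (v - u) + mu * (((1 - r (-1) - Rv) * (1 - u) - (1 - r (-1) - Ru) * (1 - v))
    + r (-1) * (u^-1 - v^-1) * ((1 - u) * (1 - v))) by rewrite /L; ring.
by rewrite ltr_wpDr.
Qed.

(** Extending the mechanism continuously across 1 gives access to its limit there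
    and to compactness arguments on intervals that end at 1. *)
Lemma immigration_rate_ext : exists f : R -> R,
  [/\ forall v : R, 0 < v -> f x @[x --> v] --> f v,
      forall v : R, 0 < v <= 1 -> f v = immigration_rate v & f 1 = q].
Proof.
have [g gc gE] := ptilde_continuous _ _ _ rn_ge0 immigration_sum.
exists (fun v => q + mu * (1 - (r (-1) / v + g v))); split.
- move=> v v0; apply: cvgD; first exact: cvg_cst.
  apply: cvgMl_tmp; apply: cvgB; first exact: cvg_cst.
  apply: cvgD; last exact: gc.
  by apply: cvgMl_tmp; apply: cvgV => //; rewrite gt_eqF.
- by move=> v /andP[v0 v1]; rewrite gE ?(ltW v0).
- by rewrite gE ?ler01 ?lexx// (ptilde1 _ _ _ immigration_sum); field.
Qed.

Lemma phiq_spec : 0 < mu * r (-1) ->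
  0 < phiq mu r q < 1 /\ immigration_rate (phiq mu r q) = 0.
Proof.
move=> mr; rewrite /phiq mr.
set rt := [set z : R | _].
suff : exists z, rt z.
  move=> /(xgetPex 0) [? h]; split=> //; rewrite /immigration_rate.
  by rewrite {1}h; ring.
have [f [fc fE f1]] := immigration_rate_ext.
have r1 : r (-1) <= 1.
  have := Rs_ge0 1; rewrite ler01 lexx => /(_ isT).
  by rewrite /Rs (ptilde1 _ _ _ immigration_sum) subr_ge0.
have qmu : 0 < q + mu by rewrite ltr_wpDr.
(* At this point [mu * r (-1) / e = q + mu], which makes the rate nonpositive. *)
pose e := mu * r (-1) / (q + mu).
have e0 : 0 < e by rewrite divr_gt0.
have e1 : e < 1 by rewrite ltr_pdivrMr// mul1r ltr_pwDl// ler_piMr.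
have fe : f e <= 0.
  rewrite fE; last by rewrite e0 ltW.
  rewrite /immigration_rate rtildeE.
  have -> : mu * (1 - (r (-1) / e + Rs e)) = mu * (1 - Rs e) - mu * r (-1) / e.
    by ring.
  have -> : mu * r (-1) / e = q + mu.
    by rewrite /e invfM invrK mulrA divff ?mul1r// gt_eqF.
  have Re : 0 <= Rs e by rewrite Rs_ge0// !ltW.
  have : mu * (1 - Rs e) <= mu by rewrite ler_piMr// gerBl.
  by lra.
have [||c] := @IVT R f e 1 0 (ltW e1).
- apply: continuous_in_subspaceT => v /set_mem/=; rewrite in_itv/= => /andP[ev _].
  by apply: fc; exact: lt_le_trans ev.
- by rewrite f1 ge_min fe/= le_max (ltW hq) orbT.
rewrite in_itv/= => /andP[ec c1] fc0; exists c.
have c0 := lt_le_trans e0 ec.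
split.
  rewrite c0/= lt_neqAle c1 andbT; apply/eqP => cE.
  by move: hq; rewrite -f1 -cE fc0 ltxx.
by move: fc0; rewrite fE ?c0// /immigration_rate; lra.
Qed.

Lemma phiq_bounds : 0 <= phiq mu r q < 1.
Proof.
have [mr|mr] := boolP (0 < mu * r (-1)).
  by have [/andP[/ltW -> ->]] := phiq_spec mr.
by rewrite /phiq (negbTE mr) lexx ltr01.
Qed.

Lemma phiq0_no_death : ~~ (0 < mu * r (-1)) -> forall v, 0 < v <= 1 ->
  q <= immigration_rate v.
Proof.
rewrite lt_neqAle mulr_ge0 ?r_ge0// andbT negbK eq_sym mulf_eq0 => /orP h v /andP[v0 v1].
rewrite /immigration_rate lerDl; case: h => [/eqP->|/eqP r0]; first by rewrite mul0r.
rewrite rtildeE r0 mul0r add0r mulr_ge0// subr_ge0.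
by have := Rs_le v; rewrite r0 subr0 (ltW v0) v1; apply.
Qed.

Lemma immigration_rate_gt0 (v : R) : phiq mu r q < v < 1 -> 0 < immigration_rate v.
Proof.
move=> /andP[qv v1]; have [mr|mr] := boolP (0 < mu * r (-1)).
  have [/andP[q0 q1] Cq] := phiq_spec mr.
  have := immigration_rate_chord _ _ q0 qv v1; rewrite Cq mul0r.
  by rewrite pmulr_lgt0// subr_gt0.
apply: lt_le_trans hq (phiq0_no_death mr _ _).
by move: qv; rewrite /phiq (negbTE mr) => ->; exact: ltW.
Qed.

Lemma immigration_rate_lt0 (v : R) : 0 < v < phiq mu r q -> immigration_rate v < 0.
Proof.
move=> /andP[v0 vq]; have [mr|mr] := boolP (0 < mu * r (-1)); last first.
  by move: vq; rewrite /phiq (negbTE mr) ltNge (ltW v0).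
have [/andP[q0 q1] Cq] := phiq_spec mr.
have := immigration_rate_chord _ _ v0 vq q1; rewrite Cq mul0r.
by rewrite pmulr_llt0// subr_gt0.
Qed.

Lemma immigration_rate_min (v0 : R) : phiq mu r q < v0 < 1 ->
  exists2 c, 0 < c & forall v, v0 <= v < 1 -> c <= immigration_rate v.
Proof.
move=> /andP[qv0 v01]; have [f [fc fE f1]] := immigration_rate_ext.
have v0gt0 : 0 < v0 by apply: le_lt_trans qv0; case/andP: phiq_bounds.
have [|c cin cmin] := @EVT_min R f v0 1 (ltW v01).
  apply: continuous_in_subspaceT => v /set_mem/=; rewrite in_itv/= => /andP[ev _].
  by apply: fc; exact: lt_le_trans ev.
move: cin; rewrite in_itv/= => /andP[v0c c1]; have c0 := lt_le_trans v0gt0 v0c.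
exists (f c).
  move: c1; rewrite le_eqVlt => /predU1P[->|c1]; first by rewrite f1.
  by rewrite fE ?c0 ?ltW// immigration_rate_gt0// c1 (lt_le_trans qv0).
move=> v /andP[v0v v1]; rewrite -fE; last by rewrite (lt_le_trans v0gt0)//= ltW.
by apply: cmin; rewrite in_itv/= v0v ltW.
Qed.

Lemma immigration_rate_near1 (e : R) : 0 < e ->
  exists2 a, 0 < a < 1 & forall v, a <= v < 1 -> `|immigration_rate v - q| < e.
Proof.
move=> e0; have [f [fc fE f1]] := immigration_rate_ext.
have /cvgrPdist_lt/(_ _ e0) := fc 1 ltr01; rewrite f1 => -[d /= d0 h].
pose m := Num.min (d / 2) (1 / 2).
have [m0 m1 md] : [/\ 0 < m, m <= 1 / 2 & m <= d / 2].
  by rewrite /m; split; rewrite ?lt_min ?ge_min ?lexx ?orbT// !divr_gt0.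
exists (1 - m); first by apply/andP; split; lra.
move=> v /andP[mv v1]; rewrite distrC -fE; last by apply/andP; split; lra.
by apply: h; rewrite /= ger0_norm; lra.
Qed.

Lemma immigration_rate_continuous (v : R) : 0 < v < 1 ->
  immigration_rate x @[x --> v] --> immigration_rate v.
Proof.
move=> /andP[v0 v1]; have [f [fc fE f1]] := immigration_rate_ext.
have := fc v v0; rewrite fE ?v0 ?ltW//; apply: cvg_trans; apply: near_eq_cvg.
near=> x; rewrite fE//; apply/andP; split; last apply: ltW; near: x.
- exact: lt_nbhsr.
- exact: lt_nbhsl.
Unshelve. all: by end_near. Qed.

End Immigration.

(** * Mixtures of geometric sequences *)

Section Moments.
Variables (R : realType) (D : set R) (w : R -> R).
Local Notation mu := (@lebesgue_measure R).
Hypotheses (mD : @measurable _ (measurableTypeR R) D) (D01 : forall v, D v -> 0 < v < 1).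
Hypotheses (w0 : forall v, D v -> 0 <= w v) (iw : mu.-integrable D (EFin \o w)).

Lemma integrable_weight (h : R -> R) (M : R) : measurable_fun D h ->
  (forall v, D v -> `|h v| <= M) -> mu.-integrable D (EFin \o (fun v => w v * h v)).
Proof.
move=> mh hM; apply: (le_integrable mD _ _ (integrableZl mD M iw)).
  apply/measurable_EFinP; apply: measurable_funM => //.
  by apply/measurable_EFinP; exact: measurable_int iw.
move=> v Dv; rewrite /= lee_fin !normrM mulrC ler_wpM2r//.
exact: le_trans (hM _ Dv) (ler_norm _).
Qed.

Lemma expr_D_le1 (v : R) n : D v -> 0 <= v ^+ n <= 1.
Proof.
by move=> /D01/andP[v0 v1]; rewrite exprn_ge0 ?exprn_ile1 ?ltW.
Qed.

Lemma integrable_moment x : mu.-integrable D (EFin \o (fun v => w v * v ^+ x)).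
Proof.
apply: (@integrable_weight _ 1); first exact: exprn_measurable.
by move=> v /(expr_D_le1 _ x)/andP[? ?]; rewrite ger0_norm.
Qed.

(** As a function of [x], the mixture of the geometric sequences [v ^+ x] with
    weights [w]. *)
Definition moment (x : nat) : R := \int[mu]_(v in D) (w v * v ^+ x).

Lemma moment_ge0 x : 0 <= moment x.
Proof.
apply: Rintegral_ge0 => v Dv.
by rewrite mulr_ge0 ?w0//; case/andP: (expr_D_le1 _ x Dv).
Qed.

Lemma moment_le x : moment x <= moment 0.
Proof.
apply: (le_Rintegral mD (integrable_moment x) (integrable_moment 0)).
move=> v Dv; rewrite expr0 ler_wpM2l ?w0//.
by case/andP: (expr_D_le1 _ x Dv).
Qed.

Lemma moment_cvg0 : moment x @[x --> \oo] --> 0.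
Proof.
have lim0 : {ae mu, forall v, D v -> (w v * v ^+ n)%:E @[n --> \oo] --> (cst 0%E v : \bar R)}.
  apply: aeW => v Dv; apply: cvg_EFin; first exact: nearW.
  rewrite -(mulr0 (w v)); apply: cvgMl_tmp.
  have /andP[v0 v1] := D01 _ Dv.
  by apply: cvg_expr; rewrite gtr0_norm.
have dom : {ae mu, forall v n, D v -> (`|(w v * v ^+ n)%:E| <= (EFin \o w) v)%E}.
  apply: aeW => v n Dv; rewrite lee_fin.
  have /andP[h0 h1] := expr_D_le1 _ n Dv.
  by rewrite ger0_norm ?mulr_ge0 ?w0// ler_piMr ?w0.
have [_ _ h] := @dominated_convergence _ _ _ mu D mD (fun n v => (w v * v ^+ n)%:E)
  (cst 0%E) (EFin \o w) (fun n => measurable_int mu (integrable_moment n))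
  (measurable_cst _) lim0 iw dom.
apply: (@fine_cvg _ _ _ _ (fun n => (\int[mu]_(v in D) (w v * v ^+ n)%:E)%E)).
by rewrite integral0 in h.
Qed.

Section Series.
Variables (c : nat -> R) (S : R).
Hypotheses (c_ge0 : forall k, 0 <= c k) (cS : series c @ \oo --> S).

Lemma measurable_ptilde : measurable_fun D (ptilde c).
Proof.
have [f fc fE] := ptilde_continuous _ _ _ c_ge0 cS.
apply: (eq_measurable_fun f).
  by move=> v /set_mem/D01/andP[? ?]; rewrite fE// !ltW.
by apply: measurable_funTS; exact: continuous_measurable_fun.
Qed.

Lemma ptilde_D_bound (v : R) n : D v -> `|v ^+ n * ptilde c v| <= S.
Proof.
move=> Dv; have /andP[v0 v1] := D01 _ Dv.
have v01 : 0 <= v <= 1 by rewrite !ltW.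
have P0 := ptilde_ge0 _ _ _ c_ge0 cS _ v01.
have /andP[e0 e1] := expr_D_le1 _ n Dv.
rewrite ger0_norm ?mulr_ge0// (le_trans (ler_piMl P0 e1))//.
by rewrite -(ptilde1 _ _ _ cS) (le_ptilde _ _ _ c_ge0 cS)// ltW.
Qed.

Lemma integrable_ptilde n : mu.-integrable D (EFin \o (fun v => w v * (v ^+ n * ptilde c v))).
Proof.
apply: (@integrable_weight _ S); last by move=> v; exact: ptilde_D_bound.
by apply: measurable_funM; [exact: exprn_measurable|exact: measurable_ptilde].
Qed.

Lemma integrable_series m n : mu.-integrable D
  (EFin \o (fun v => w v * (v ^+ m * series (fun k => c k * v ^+ k) n))).
Proof.
apply: (@integrable_weight _ S).
  apply: measurable_funM; first exact: exprn_measurable.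
  apply: measurable_sum => k; apply: measurable_funM; first exact: measurable_cst.
  exact: exprn_measurable.
move=> v Dv; have /andP[v0 v1] := D01 _ Dv.
have v01 : 0 <= v <= 1 by rewrite !ltW.
have /andP[h _] := ptilde_tail _ _ _ c_ge0 cS _ n v01.
apply: le_trans (ptilde_D_bound _ m Dv).
have s0 : 0 <= series (fun k => c k * v ^+ k) n.
  by rewrite seriesEnat/=; apply: sumr_ge0 => k _; rewrite mulr_ge0// exprn_ge0// ltW.
rewrite !normrM ler_wpM2l// ger0_norm//.
by rewrite (le_trans _ (ler_norm _))// -subr_ge0.
Qed.

Lemma series_momentE m n : series (fun k => c k * moment (m + k)%N) n =
  \int[mu]_(v in D) (w v * (v ^+ m * series (fun k => c k * v ^+ k) n)).
Proof.
elim: n => [|n IH].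
  rewrite seriesEnat/= big_geq//; apply/esym; rewrite /Rintegral.
  by under eq_integral do rewrite seriesEnat/= big_geq// !mulr0; rewrite integral0.
rewrite seriesSr /= [in LHS]IH /moment.
rewrite -RintegralZl//; last exact: integrable_moment.
rewrite -RintegralD//; first last.
- by have := integrableZl mD (c n) (integrable_moment (m + n)%N).
- exact: integrable_series.
by apply: eq_Rintegral => v _; rewrite seriesSr exprD; ring.
Qed.

(** Exchange of integral and series: the error is at most the tail of the
    coefficients times the total weight. *)
Lemma cvg_series_moment m : series (fun k => c k * moment (m + k)%N) @ \oo -->
  \int[mu]_(v in D) (w v * (v ^+ m * ptilde c v)).
Proof.
set L := Rintegral _ _ _.
have err n : 0 <= L - series (fun k => c k * moment (m + k)%N) n
    <= (S - series c n) * moment 0.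
  rewrite series_momentE /L -RintegralB//; first last.
  - exact: integrable_series.
  - exact: integrable_ptilde.
  have E : \int[mu]_(v in D) (w v * (v ^+ m * ptilde c v) -
      w v * (v ^+ m * series (fun k => c k * v ^+ k) n)) =
      \int[mu]_(v in D) (w v * (v ^+ m * (ptilde c v - series (fun k => c k * v ^+ k) n))).
    by apply: eq_Rintegral => v _; ring.
  have bd v : D v -> 0 <= v ^+ m * (ptilde c v - series (fun k => c k * v ^+ k) n) <= S - series c n.
    move=> Dv; have /andP[v0 v1] := D01 _ Dv.
    have v01 : 0 <= v <= 1 by rewrite !ltW.
    have /andP[t0 t1] := ptilde_tail _ _ _ c_ge0 cS _ n v01.
    have /andP[e0 e1] := expr_D_le1 _ m Dv.
    by rewrite mulr_ge0//= (le_trans _ t1)// ler_piMl.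
  rewrite E; apply/andP; split.
    by apply: Rintegral_ge0 => v Dv; rewrite mulr_ge0 ?w0//; case/andP: (bd _ Dv).
  rewrite /moment -RintegralZl//; last exact: integrable_moment.
  apply: le_Rintegral => //.
  - have h1 := integrable_ptilde m; have h2 := integrable_series m n.
    apply: eq_integrable (integrableB mD h1 h2) => //.
    by move=> v _ /=; rewrite -EFinB; congr EFin; ring.
  - by have := integrableZl mD (S - series c n) (integrable_moment 0).
  - move=> v Dv; rewrite expr0 mulr1 mulrC ler_wpM2r ?w0//.
    by case/andP: (bd _ Dv).
have lim : (S - series c n) * moment 0 @[n --> \oo] --> 0.
  rewrite -(mul0r (moment 0)) -(subrr S); apply: cvgMr_tmp.
  by apply: cvgB => //; exact: cvg_cst.
have h : L - series (fun k => c k * moment (m + k)%N) n @[n --> \oo] --> 0.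
  apply: (@squeeze_cvgr _ _ _ _ (cst 0) (fun n => (S - series c n) * moment 0)) => //.
    by apply: nearW; exact: err.
  exact: cvg_cst.
have -> : series (fun k => c k * moment (m + k)%N) =
    fun n => L - (L - series (fun k => c k * moment (m + k)%N) n).
  by apply/funext => n; rewrite subKr.
by rewrite -[X in _ --> X]subr0; apply: cvgB => //; exact: cvg_cst.
Qed.

End Series.
End Moments.

(** * The resolvent equation for mixtures *)

Section Resolvent.
Variables (R : realType) (lambda mu : R) (p : nat -> R) (r : int -> R) (q : R).
Hypotheses (hlambda : 0 < lambda) (hmu : 0 <= mu).
Hypotheses (hp : offspring_law p) (hr : immigration_law r) (hq : 0 < q).
Local Notation leb := (@lebesgue_measure R).
Local Notation C := (immigration_rate R mu r q).
Local Notation rho := (rho lambda p).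
Local Notation gam := (gammaq lambda mu p r q).

(** The off-diagonal part of the generator. *)
Definition jump_op (f : nat -> R) (x : nat) : R :=
  lambda * x%:R * limn (series (fun k => p k * f (x + k - 1)%N)) +
  mu * (r (-1) * f (x - 1)%N + limn (series (fun k : nat => r k%:Z * f (x + k)%N))).

Let p_ge0 : forall k, 0 <= p k. Proof. by case: hp. Qed.
Let p_sum : series p @ \oo --> (1 : R). Proof. by case: hp. Qed.
Let rn_ge0 (k : nat) : 0 <= r k%:Z. Proof. by case: hr. Qed.
Let r_sum := immigration_sum _ _ hr.

(** Each [v ^+ x] satisfies
    [(q - Q) v^x = C(v) v^x - lambda (ptilde(v) - v) (v^x)'], and mixing over [v]
    commutes with the two series of the generator. *)
Lemma resolvent_moment (D : set R) (w : R -> R) x :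
  @measurable _ (measurableTypeR R) D -> (forall v, D v -> 0 < v < 1) ->
  (forall v, D v -> 0 <= w v) -> leb.-integrable D (EFin \o w) -> (0 < x)%N ->
  let g v := w v * (C v * v ^+ x - lambda * (ptilde p v - v) * (x%:R * v ^+ x.-1)) in
  leb.-integrable D (EFin \o g) /\
  (q + lambda * x%:R + mu) * moment _ D w x - jump_op (moment _ D w) x =
  \int[leb]_(v in D) g v.
Proof.
move=> mD D01 w0 iw; case: x => // n _ g.
have iA := integrable_moment _ _ _ mD D01 iw n.+1.
have iB := integrable_ptilde _ _ _ mD D01 iw _ _ p_ge0 p_sum n.
have iC := integrable_moment _ _ _ mD D01 iw n.
have iE := integrable_ptilde _ _ _ mD D01 iw _ _ rn_ge0 r_sum n.+1.
set a := q + lambda * n.+1%:R + mu.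
pose A := fun v => w v * v ^+ n.+1.
pose B := fun v => w v * (v ^+ n * ptilde p v).
pose F := fun v => w v * v ^+ n.
pose E := fun v => w v * (v ^+ n.+1 * ptilde (fun k : nat => r k%:Z) v).
have iaA : leb.-integrable D (EFin \o (fun v => a * A v)) by have := integrableZl mD a iA.
have ibB : leb.-integrable D (EFin \o (fun v => lambda * n.+1%:R * B v)).
  by have := integrableZl mD (lambda * n.+1%:R) iB.
have icF : leb.-integrable D (EFin \o (fun v => mu * r (-1) * F v)).
  by have := integrableZl mD (mu * r (-1)) iC.
have idE : leb.-integrable D (EFin \o (fun v => mu * E v)).
  by have := integrableZl mD mu iE.
have iFE : leb.-integrable D (EFin \o (fun v => mu * r (-1) * F v + mu * E v)).
  by have := integrableD mD icF idE.
have iBFE : leb.-integrable D (EFin \o (fun v => lambda * n.+1%:R * B v +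
    (mu * r (-1) * F v + mu * E v))).
  by have := integrableD mD ibB iFE.
have iT : leb.-integrable D (EFin \o (fun v => a * A v - (lambda * n.+1%:R * B v +
    (mu * r (-1) * F v + mu * E v)))).
  by have := integrableB mD iaA iBFE.
have gE v : D v -> g v = a * A v - (lambda * n.+1%:R * B v +
    (mu * r (-1) * F v + mu * E v)).
  move=> Dv; have /andP[v0 v1] := D01 _ Dv.
  rewrite /g /A /B /F /E /a /immigration_rate.
  have -> : rtilde r v = r (-1) / v + ptilde (fun k : nat => r k%:Z) v by [].
  move: (ptilde _ v) (ptilde _ v) => P Q /=; rewrite exprS.
  by field; rewrite gt_eqF.
split.
  by apply: eq_integrable iT => // v /set_mem Dv /=; rewrite gE.
rewrite (_ : \int[leb]_(v in D) g v = \int[leb]_(v in D) (a * A v - (lambda * n.+1%:R * B v +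
    (mu * r (-1) * F v + mu * E v)))); last first.
  by apply: eq_Rintegral => v /set_mem; exact: gE.
rewrite RintegralB// RintegralD// RintegralD//.
rewrite !RintegralZl//.
rewrite /jump_op.
have -> : (fun k => p k * moment R D w (n.+1 + k - 1)%N) = fun k => p k * moment R D w (n + k)%N.
  by apply/funext => k; rewrite addSn subn1.
rewrite (cvg_lim _ (cvg_series_moment _ _ _ mD D01 w0 iw _ _ p_ge0 p_sum n))//.
rewrite (cvg_lim _ (cvg_series_moment _ _ _ mD D01 w0 iw _ _ rn_ge0 r_sum n.+1))//.
rewrite subn1 /= -/(moment R D w n) -/(moment R D w n.+1) /B /E.
ring.
Qed.

Lemma gammaq_continuous (v : R) : 0 < v < 1 -> v != phi p ->
  gam x @[x --> v] --> gam v.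
Proof.
move=> v01 vphi; apply: cvgM; first exact: (immigration_rate_continuous _ _ _ _ hr _ v01).
apply: cvgV; first by rewrite gt_eqF// (rho_gt0 _ _ _ hlambda hp).
exact: rho_continuous.
Qed.

(** The kernel [e / rho] turns the resolvent equation into an exact derivative:
    with [s] the sign of [ptilde - id] and [e' = - s * gammaq * e], the integrand
    of [resolvent_moment] is [- s] times the derivative of [e(v) v^x]. *)
Lemma resolvent_kernel (a b s : R) (e : R -> R) x (la lb : R) :
  0 <= a -> a < b -> b <= 1 -> s * s = 1 ->
  (forall v, a < v < b -> v != phi p) ->
  (forall v, a < v < b -> lambda * (ptilde p v - v) = s * rho v) ->
  (forall v, a < v < b -> 0 <= e v) ->
  primitive_oo R a b e (fun v => - (s * (gam v * e v))) ->
  leb.-integrable `]a, b[ (EFin \o (fun v => e v / rho v)) ->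
  (0 < x)%N ->
  e v * v ^+ x @[v --> a^'+] --> la -> e v * v ^+ x @[v --> b^'-] --> lb ->
  (q + lambda * x%:R + mu) * moment _ `]a, b[ (fun v => e v / rho v) x -
    jump_op (moment _ `]a, b[ (fun v => e v / rho v)) x = - (s * (lb - la)).
Proof.
move=> a0 ab b1 ss nphi sA e0 de iw x0 hla hlb.
have D01 v : a < v < b -> 0 < v < 1.
  by move=> /andP[av vb]; rewrite (le_lt_trans a0)//= (lt_le_trans vb).
have rho0 v : a < v < b -> 0 < rho v.
  by move=> vab; rewrite (rho_gt0 _ _ _ hlambda hp) ?nphi ?D01.
have [|v|v|ig ->] := resolvent_moment `]a, b[%classic (fun v => e v / rho v) x _ _ _ iw x0 => //.
- by rewrite /= in_itv/=; exact: D01.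
- rewrite /= in_itv/= => vab; rewrite divr_ge0 ?e0//.
  by rewrite ltW ?rho0.
pose G v := e v * v ^+ x.
pose g v := e v * (x%:R * v ^+ x.-1) + v ^+ x * - (s * (gam v * e v)).
have dG : primitive_oo R a b G g.
  move=> v vab; have dev := de v vab.
  have dX : is_derive v 1 (fun y : R => y ^+ x) (x%:R * v ^+ x.-1).
    by have := is_deriveX x (is_derive_id v (1 : R)); rewrite exprfctE /GRing.scale/= mulr1.
  exact: (is_deriveM dev dX).
have ce := primitive_oo_continuous _ _ _ _ _ de.
have cg : continuous_oo R a b g.
  move=> v vab.
  have cX n : y ^+ n @[y --> v] --> v ^+ n by exact: exprn_continuous.
  apply: cvgD; first by apply: cvgM; [exact: ce|apply: cvgMl_tmp; exact: cX].
  apply: cvgM; first exact: cX.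
  apply: cvgN; apply: cvgMl_tmp; apply: cvgM; last exact: ce.
  by apply: gammaq_continuous; [exact: D01|exact: nphi].
have gE v : a < v < b -> e v / rho v * (C v * v ^+ x - lambda * (ptilde p v - v)
    * (x%:R * v ^+ x.-1)) = - s * g v.
  move=> vab; rewrite sA// /g.
  have -> : - s * (e v * (x%:R * v ^+ x.-1) + v ^+ x * - (s * (gam v * e v))) =
    (s * s) * (gam v * e v * v ^+ x) - s * (e v * (x%:R * v ^+ x.-1)) by ring.
  rewrite ss mul1r /gammaq -/(C v); field.
  by rewrite gt_eqF// rho0.
have ig' : leb.-integrable `]a, b[ (EFin \o g).
  have mab : @measurable _ (measurableTypeR R) `]a, b[%classic by exact: measurable_itv.
  have := integrableZl mab (- s) ig; apply: eq_integrable => //.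
  move=> v /set_mem/=; rewrite in_itv/= => vab.
  by rewrite -EFinM gE// mulrA mulrNN ss mul1r.
rewrite (_ : Rintegral _ _ _ = \int[leb]_(v in `]a, b[) (- s * g v)); last first.
  by apply: eq_Rintegral => v /set_mem/=; rewrite in_itv/=; exact: gE.
rewrite RintegralZl//= /Rintegral.
by rewrite (integral_primitive_cvg _ _ _ ab _ _ _ _ dG cg hla hlb ig')/= mulNr.
Qed.
End Resolvent.

(** * Kernels and their mass *)

Section PositiveIntegral.
Variable R : realType.
Local Notation leb := (@lebesgue_measure R).

Lemma Rintegral_itvoo_gt0 (a b : R) (f : R -> R) : a < b ->
  leb.-integrable `]a, b[ (EFin \o f) -> (forall v, a < v < b -> 0 < f v) ->
  0 < \int[leb]_(v in `]a, b[) f v.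
Proof.
move=> ab intf f0.
have f0' v : v \in `]a, b[ -> 0 <= f v by rewrite in_itv/= => /f0/ltW.
rewrite lt_neqAle Rintegral_ge0 ?andbT; last by move=> v; exact: f0'.
apply/eqP => f0E.
have mab : @measurable _ (measurableTypeR R) `]a, b[%classic by exact: measurable_itv.
have I0 : (\int[leb]_(v in `]a, b[) (f v)%:E = 0)%E.
  by rewrite -[LHS]fineK ?integrable_fin_num//; congr EFin; rewrite f0E.
have : (\int[leb]_(v in `]a, b[) `|(f v)%:E| = 0)%E.
  rewrite -[RHS]I0; apply: eq_integral => v /set_mem/f0' fv.
  by rewrite /= ger0_norm.
move=> /(ae_eq_integral_abs leb mab (measurable_int leb intf)) [N [mN N0 subN]].
have : (leb `]a, b[%classic <= leb N)%E.
  apply: le_measure; rewrite ?inE// => v /=; rewrite in_itv/= => vab; apply: subN => /=.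
  rewrite in_itv/= vab => /(_ isT) /= -[fv0].
  by have := f0 v vab; rewrite fv0 ltxx.
rewrite [X in (_ <= X)%E -> _]N0 lebesgue_measure_itv/= lte_fin ab.
by rewrite -EFinB lee_fin subr_le0 leNgt ab.
Qed.
End PositiveIntegral.

Section KernelIntegrable.
Variables (R : realType) (lambda mu : R) (p : nat -> R) (r : int -> R) (q : R).
Hypotheses (hlambda : 0 < lambda).
Hypotheses (hp : offspring_law p) (hr : immigration_law r).
Local Notation leb := (@lebesgue_measure R).
Local Notation C := (immigration_rate R mu r q).
Local Notation rho := (rho lambda p).
Local Notation gam := (gammaq lambda mu p r q).

Lemma gammaqE v : gam v = C v / rho v. Proof. by []. Qed.

Variables (a b s : R) (e : R -> R) (la lb c : R).
Hypotheses (a0 : 0 <= a) (ab : a < b) (b1 : b <= 1) (ss : s * s = 1).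
Hypothesis nphi : forall v, a < v < b -> v != phi p.
Hypothesis e0 : forall v, a < v < b -> 0 <= e v.
Hypothesis de : primitive_oo R a b e (fun v => - (s * (gam v * e v))).
Hypotheses (hla : e v @[v --> a^'+] --> la) (hlb : e v @[v --> b^'-] --> lb).
Hypotheses (c0 : 0 < c) (hc : forall v, a < v < b -> c <= C v).

Let D01 v : a < v < b -> 0 < v < 1.
Proof.
by move=> /andP[av vb]; rewrite (le_lt_trans a0)//= (lt_le_trans vb).
Qed.

Let rho0 v : a < v < b -> 0 < rho v.
Proof. by move=> vab; rewrite (rho_gt0 _ _ _ hlambda hp) ?nphi ?D01. Qed.

Let mab : @measurable _ (measurableTypeR R) `]a, b[%classic.
Proof. exact: measurable_itv. Qed.

Let ce : continuous_oo R a b e.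
Proof. exact: primitive_oo_continuous de. Qed.

Let cge : continuous_oo R a b (fun v => gam v * e v).
Proof.
move=> v vab; apply: cvgM; last exact: ce.
by apply: (gammaq_continuous _ _ _ _ _ _ hlambda hp hr); [exact: D01|exact: nphi].
Qed.

Let ge0 v : a < v < b -> 0 <= gam v * e v.
Proof.
move=> vab; rewrite mulr_ge0 ?e0// gammaqE divr_ge0// ?ltW ?rho0//.
by apply: lt_le_trans c0 _; exact: hc.
Qed.

Let intge : (\int[leb]_(v in `]a, b[) (gam v * e v)%:E = (- (s * (lb - la)))%:E)%E.
Proof.
have dG : primitive_oo R a b (fun v => - s * e v) (fun v => gam v * e v).
  move=> v vab; have dev := de v vab.
  have -> : gam v * e v = - s *: - (s * (gam v * e v)).
    rewrite /GRing.scale/=; transitivity (s * s * (gam v * e v)); last by ring.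
    by rewrite ss mul1r.
  exact: (is_deriveZ (- s) dev).
rewrite (ge0_integral_primitive_cvg _ _ _ ab _ _ (- s * la) (- s * lb) dG cge) //.
- by congr EFin; ring.
- by apply: cvgMl_tmp.
- by apply: cvgMl_tmp.
Qed.

Let ige : leb.-integrable `]a, b[ (EFin \o (fun v => gam v * e v)).
Proof.
apply/integrableP; split.
  by apply/measurable_EFinP; exact: measurable_oo cge.
have -> : (\int[leb]_(v in `]a, b[) `|(EFin \o (fun v => (gam v * e v)%R)) v| =
    (- (s * (lb - la)))%:E)%E; last exact: ltry.
rewrite -intge; apply: eq_integral.
by move=> v /set_mem/=; rewrite in_itv/= => vab; rewrite ger0_norm ?ge0.
Qed.

(** [e / rho = gammaq e / C], where [gammaq e] is up to sign the derivative of [e] and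
    [C] is bounded below. *)
Lemma kernel_integrable : leb.-integrable `]a, b[ (EFin \o (fun v => e v / rho v)).
Proof.
apply: (le_integrable mab _ _ (integrableZl mab c^-1 ige)).
  apply/measurable_EFinP; apply: measurable_oo => v vab; apply: cvgM; first exact: ce.
  apply: cvgV; first by rewrite gt_eqF ?rho0.
  by apply: rho_continuous => //; exact: D01.
move=> v; rewrite /= in_itv/= => vab.
have e0v := e0 v vab; have r0 := rho0 _ vab.
have er0 : 0 <= e v / rho v by rewrite divr_ge0// ltW.
have cge0 : 0 <= c^-1 * (gam v * e v) by apply: mulr_ge0; [rewrite invr_ge0 ltW|exact: ge0].
rewrite lee_fin (ger0_norm er0) (ger0_norm cge0).
by rewrite ler_pdivlMl// gammaqE mulrAC -mulrA ler_wpM2r ?hc.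
Qed.

(** As [gammaq e] integrates to the increment of [e], bounds on [C] turn into bounds on
    the total mass. *)
Lemma kernel_mass_le : c * moment _ `]a, b[ (fun v => e v / rho v) 0 <= - (s * (lb - la)).
Proof.
have iK := kernel_integrable.
have -> : - (s * (lb - la)) = \int[leb]_(v in `]a, b[) (gam v * e v).
  by rewrite /Rintegral intge.
rewrite /moment -RintegralZl//; last first.
  by apply: eq_integrable iK => // v _ /=; rewrite expr0 mulr1.
apply: le_Rintegral => //.
  have := integrableZl mab c iK; apply: eq_integrable => // v _.
  by rewrite /= expr0 mulr1.
move=> v; rewrite /= in_itv/= => vab; rewrite expr0 mulr1 gammaqE mulrAC -mulrA ler_wpM2r ?hc//.
by rewrite divr_ge0 ?e0// ltW ?rho0.
Qed.

Lemma kernel_mass_ge (c' : R) : (forall v, a < v < b -> C v <= c') ->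
  - (s * (lb - la)) <= c' * moment _ `]a, b[ (fun v => e v / rho v) 0.
Proof.
move=> hc'; have iK := kernel_integrable.
have -> : - (s * (lb - la)) = \int[leb]_(v in `]a, b[) (gam v * e v).
  by rewrite /Rintegral intge.
rewrite /moment -RintegralZl//; last first.
  by apply: eq_integrable iK => // v _ /=; rewrite expr0 mulr1.
apply: le_Rintegral => //.
  have := integrableZl mab c' iK; apply: eq_integrable => // v _.
  by rewrite /= expr0 mulr1.
move=> v; rewrite /= in_itv/= => vab; rewrite expr0 mulr1 gammaqE mulrAC -mulrA ler_wpM2r ?hc'//.
by rewrite divr_ge0 ?e0// ltW ?rho0.
Qed.

Lemma moment_ge_expr x : a ^+ x * moment _ `]a, b[ (fun v => e v / rho v) 0 <=
  moment _ `]a, b[ (fun v => e v / rho v) x.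
Proof.
have iK := kernel_integrable.
have D01' v : v \in `]a, b[ -> 0 < v < 1 by rewrite in_itv/=; exact: D01.
have K0 v : v \in `]a, b[ -> 0 <= e v / rho v.
  by rewrite in_itv/= => vab; rewrite divr_ge0 ?e0// ltW ?rho0.
have iM n := integrable_moment _ _ _ mab D01' iK n.
rewrite {1}/moment -RintegralZl//.
apply: le_Rintegral => //; first by have := integrableZl mab (a ^+ x) (iM 0%N).
move=> v vab; rewrite expr0 mulr1 mulrC ler_wpM2l ?K0//.
have /andP[v0 v1] := D01' v vab; move: vab; rewrite /= in_itv/= => /andP[av vb].
by rewrite lerXn2r ?nnegrE// ltW.
Qed.
End KernelIntegrable.

(** * The kernel below the fixed point *)

Section Phi.
Variables (R : realType) (lambda mu : R) (p : nat -> R) (r : int -> R) (q : R).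
Hypotheses (hlambda : 0 < lambda) (hmu : 0 <= mu).
Hypotheses (hp : offspring_law p) (hr : immigration_law r) (hq : 0 < q).
Local Notation leb := (@lebesgue_measure R).
Local Notation C := (immigration_rate R mu r q).
Local Notation rho := (rho lambda p).
Local Notation gam := (gammaq lambda mu p r q).
Local Notation zq := (phiq mu r q).
Local Notation ph := (phi p).

Lemma gammaq_gt0 (v : R) : zq < v < 1 -> v != ph -> 0 < gam v.
Proof.
move=> qv vphi; have /andP[z0 _] := phiq_bounds _ _ _ _ hmu hr hq.
rewrite gammaqE divr_gt0 ?immigration_rate_gt0// (rho_gt0 _ _ _ hlambda hp)//.
by move: qv => /andP[zv ->]; rewrite (le_lt_trans z0).
Qed.

Lemma gammaq_lt0 (v : R) : 0 < v < zq -> v != ph -> gam v < 0.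
Proof.
move=> vq vphi; have /andP[_ z1] := phiq_bounds _ _ _ _ hmu hr hq.
rewrite gammaqE pmulr_llt0 ?immigration_rate_lt0// invr_gt0 (rho_gt0 _ _ _ hlambda hp)//.
by move: vq => /andP[-> vz]; rewrite (lt_trans vz).
Qed.

Hypothesis zph : zq < ph.

Let ph0 : 0 < ph. Proof. by case: (phi_spec _ _ hp). Qed.
Let ph1 : ph <= 1. Proof. by case: (phi_spec _ _ hp). Qed.
Let z0 : 0 <= zq. Proof. by case/andP: (phiq_bounds _ _ _ _ hmu hr hq). Qed.

Let in01 v : 0 < v < ph -> 0 < v < 1.
Proof. by move=> /andP[-> vp]; rewrite (lt_le_trans vp). Qed.

Let nph v : 0 < v < ph -> v != ph.
Proof. by move=> /andP[_ vp]; rewrite lt_eqF. Qed.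

Let cgam : continuous_oo R 0 ph gam.
Proof.
by move=> v vab; apply: (gammaq_continuous _ _ _ _ _ _ hlambda hp hr); [exact: in01|exact: nph].
Qed.

(** When there is no root [phiq] the exponent starts at 0, where [gammaq] stays
    bounded. *)
Let exponent0 (G : R -> R) : zq = 0 -> primitive_oo R 0 ph G gam ->
  exists l, forall v, 0 < v < ph -> oriented_integral gam 0 v = (G v - l)%:E.
Proof.
move=> zq0 dG; pose v0 := ph / 2.
have [v00 v0p] : 0 < v0 /\ v0 < ph by have := ph0; have := zph; rewrite /v0 => ? ?; split; lra.
have g0 v : 0 < v < ph -> 0 <= gam v.
  move=> vab; have /andP[? ?] := vab; apply/ltW/gammaq_gt0; last exact: nph.
  by rewrite zq0 in01.
pose M := (q + mu) / rho v0.
have r0 : 0 < rho v0 by apply: (rho_gt0 _ _ _ hlambda hp); [apply: in01|apply: nph]; rewrite v00.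
have gM v : 0 < v <= v0 -> gam v <= M.
  move=> /andP[v_0 vv]; have vab : 0 < v < ph by rewrite v_0 (le_lt_trans vv).
  rewrite gammaqE; apply: ler_pM.
  - by apply/ltW/(immigration_rate_gt0 _ _ _ _ hmu hr hq); rewrite zq0 in01.
  - by rewrite invr_ge0 ltW// (rho_gt0 _ _ _ hlambda hp) ?in01 ?nph.
  - by apply: (immigration_rate_le _ _ _ _ hmu hr); exact: in01.
  - rewrite lef_pV2 ?posrE//; last by rewrite (rho_gt0 _ _ _ hlambda hp) ?in01 ?nph.
    exact: (rho_decr _ _ _ hlambda hp).
have mono u v : 0 < u -> u <= v -> v < ph -> G u <= G v.
  by move=> u0 uv vp; apply: (primitive_oo_le _ _ _ _ _ _ _ dG).
have Glim : G x @[x --> 0^'+] --> inf (G @` `]0, v0[).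
  apply: (@nondecreasing_at_right_cvgr R G 0 (BLeft v0)); first by rewrite bnd_simp.
    move=> u v; rewrite !in_itv/= => /andP[u0 _] /andP[_ vv] uv.
    by apply: mono => //; exact: lt_trans v0p.
  exists (G v0 - M * v0) => y [v /=]; rewrite in_itv/= => /andP[v_0 vv] <-.
  have [c /andP[vc cv] E] := MVT_oo _ _ _ _ _ _ _ dG v_0 (ltW vv) v0p.
  have : gam c * (v0 - v) <= M * v0.
    apply: ler_pM; rewrite ?subr_ge0 ?(ltW vv)//.
    - by apply: g0; rewrite (lt_le_trans v_0)//= (le_lt_trans cv).
    - by apply: gM; rewrite cv (lt_le_trans v_0).
    - by rewrite gerBl ltW.
  lra.
exists (inf (G @` `]0, v0[)) => v /andP[v_0 vp]; rewrite /oriented_integral (ltW v_0).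
have dGv : primitive_oo R 0 v G gam by apply: primitive_oo_sub dG => //; exact: ltW.
have cgv : continuous_oo R 0 v gam by apply: continuous_oo_sub cgam => //; exact: ltW.
apply: (ge0_integral_primitive_cvg _ _ _ v_0 _ _ _ _ dGv cgv Glim).
  apply: cvg_at_left_filter; apply: (primitive_oo_continuous _ _ _ _ _ dG).
  by rewrite v_0.
by move=> x /andP[x0 xv]; apply: g0; rewrite x0 (lt_trans xv).
Qed.

Lemma Phi_exponent : exists2 G : R -> R, primitive_oo R 0 ph G gam &
  forall v, 0 < v < ph -> oriented_integral gam zq v = (G v)%:E.
Proof.
have [G dG] := primitive_ex _ _ _ _ ph0 cgam.
move: (z0); rewrite le_eqVlt => /predU1P[zq0|zpos].
  have [l hl] := exponent0 G (esym zq0) dG.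
  by exists (fun v => G v - l); [exact: primitive_oo_addC|rewrite -zq0].
exists (fun v => G v - G zq); first exact: primitive_oo_addC.
move=> v /andP[v0 vp]; rewrite /oriented_integral; case: ifPn => zv.
  by rewrite (integral_primitive_oo _ _ _ _ _ _ _ dG cgam zpos zv vp).
rewrite -ltNge in zv.
by rewrite (integral_primitive_oo _ _ _ _ _ _ _ dG cgam v0 (ltW zv) zph) -EFinN opprB.
Qed.

(** The exponent is measured from [phiq], the point where [gammaq] changes sign. *)
Lemma oriented_gammaq_ge0 (v : R) : 0 < v < ph -> (0 <= oriented_integral gam zq v)%E.
Proof.
move=> /andP[v0 vp]; rewrite /oriented_integral; case: ifPn => zv.
  apply: integral_ge0 => x /=; rewrite in_itv/= lee_fin => /andP[zx xv].
  have xp := lt_trans xv vp.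
  by apply/ltW/gammaq_gt0; rewrite ?lt_eqF// zx (lt_le_trans xp).
have gN x : `]v, zq[%classic x -> (0 <= - (gam x)%:E)%E.
  rewrite /= in_itv/= lee_fin oppr_ge0 => /andP[vx xz].
  apply/ltW/gammaq_lt0; first by rewrite xz (lt_trans v0).
  by rewrite lt_eqF// (lt_trans xz).
rewrite (_ : (\int[leb]_(x in `]v, zq[) (gam x)%:E =
    \int[leb]_(x in `]v, zq[) - - (gam x)%:E)%E); last first.
  by apply: eq_integral => x _; rewrite oppeK.
by rewrite integral_ge0N// oppeK; exact: integral_ge0.
Qed.

(** The exponent is nonnegative and diverges logarithmically at [phi], so [e] is at
    most 1 and vanishes at [phi]. Near 0 the kernel is bounded because [rho] is
    decreasing; near [phi] its mass is controlled by the increment of [e]. *)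
Lemma Phi_kernel : exists e : R -> R,
  [/\ forall v, 0 < v < ph -> 0 < e v <= 1,
      forall v, 0 < v < ph -> expeR (- oriented_integral gam zq v) = (e v)%:E,
      primitive_oo R 0 ph e (fun v => - (1 * (gam v * e v))),
      e v @[v --> ph^'-] --> 0
    & leb.-integrable `]0, ph[ (EFin \o (fun v => e v / rho v))].
Proof.
have [G dG GE] := Phi_exponent.
pose e v := expR (- G v); exists e.
have e1 v : 0 < v < ph -> 0 < e v <= 1.
  move=> vab; rewrite expR_gt0/= expR_le1 oppr_le0 -lee_fin -GE//.
  exact: oriented_gammaq_ge0.
have de : primitive_oo R 0 ph e (fun v => - (1 * (gam v * e v))).
  move=> v vab; have dGv := dG v vab.
  have := @is_derive1_comp R (@expR R) (fun v => - G v) v _ _ (is_derive_expR _) (is_deriveN dGv).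
  by rewrite mul1r mulrN mulrC.
pose v0 := (zq + ph) / 2.
have [zv v0p] : zq < v0 /\ v0 < ph by have := ph0; have := zph; rewrite /v0 => ? ?; split; lra.
have v00 : 0 < v0 := le_lt_trans z0 zv.
have v01 : v0 < 1 := lt_le_trans v0p ph1.
have [c c0 hc] : exists2 c, 0 < c & forall v, v0 <= v < 1 -> c <= C v.
  by apply: (immigration_rate_min _ _ _ _ hmu hr hq); rewrite zv.
have sub v : v0 < v < ph -> 0 < v < ph.
  by move=> /andP[vv ->]; rewrite (lt_trans v00).
have elim : e v @[v --> ph^'-] --> 0.
  have hk : 0 < c / lambda by rewrite divr_gt0.
  apply: (expRN_primitive_at_left _ _ _ _ _ _ v0p hk).
    by apply: primitive_oo_sub dG => //; exact: ltW.
  move=> x xab; have x0 := sub _ xab; have /andP[v0x xp] := xab.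
  have r0 : 0 < rho x by rewrite (rho_gt0 _ _ _ hlambda hp) ?in01 ?nph.
  have px : 0 < ph - x by rewrite subr_gt0.
  rewrite gammaqE ler_pdivrMr// mulrAC ler_pdivlMr//.
  apply: le_trans (_ : c / lambda * (lambda * (ph - x)) <= _).
    by rewrite ler_wpM2l ?(ltW hk)// (rho_le_left _ _ _ hlambda hp).
  rewrite mulrA divfK ?gt_eqF// ler_wpM2r ?(ltW px)// hc//.
  by rewrite (ltW v0x) (lt_le_trans xp).
split => //; first by move=> v vab; rewrite GE.
have iK : leb.-integrable `]v0, ph[ (EFin \o (fun v => e v / rho v)).
  have ev0 : e v @[v --> v0^'+] --> e v0.
    apply: cvg_at_right_filter; apply: (primitive_oo_continuous _ _ _ _ _ de).
    by rewrite v00.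
  apply: (kernel_integrable _ _ _ _ _ _ hlambda hp hr _ _ 1 _ (e v0) 0 c _ v0p ph1) => //.
  - exact: ltW.
  - by rewrite mulr1.
  - by move=> v /sub/nph.
  - by move=> v /sub/e1/andP[/ltW].
  - by apply: primitive_oo_sub de => //; exact: ltW.
  - by move=> v /andP[/ltW vv vp]; rewrite hc// vv (lt_le_trans vp).
have mab : @measurable _ (measurableTypeR R) `]0, ph[%classic by exact: measurable_itv.
have mvb : @measurable _ (measurableTypeR R) `]v0, ph[%classic by exact: measurable_itv.
pose K := (EFin \o (fun v => e v / rho v)) : measurableTypeR R -> \bar R.
have iKp : leb.-integrable `]0, ph[ (K \_ `]v0, ph[).
  have := (integrable_mkcond K mvb).1 iK.
  by apply: integrableS.
have icst : leb.-integrable `]0, ph[ (EFin \o cst (rho v0)^-1).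
  have : leb.-integrable `[0, ph] (EFin \o cst (rho v0)^-1).
    apply: continuous_compact_integrable; first exact: segment_compact.
    by apply: continuous_subspaceT => v; exact: cvg_cst.
  by apply: integrableS => //; exact: subset_itv_oo_cc.
have r0 : 0 < rho v0 by rewrite (rho_gt0 _ _ _ hlambda hp) ?v00// lt_eqF.
have := integrableD mab icst iKp; apply: le_integrable => //.
  apply/measurable_EFinP; apply: measurable_oo => v vab; apply: cvgM.
    exact: (primitive_oo_continuous _ _ _ _ _ de).
  apply: cvgV; first by rewrite gt_eqF// (rho_gt0 _ _ _ hlambda hp) ?in01 ?nph.
  by apply: rho_continuous => //; exact: in01.
move=> v; rewrite /= in_itv/= => vab.
have rv0 : 0 < rho v by rewrite (rho_gt0 _ _ _ hlambda hp) ?in01 ?nph.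
have /andP[/ltW ev0 ev1] := e1 v vab.
have K0 : 0 <= e v / rho v by rewrite divr_ge0// ltW.
rewrite /patch; case: ifPn => vin.
  by rewrite -EFinD /= lee_fin !ger0_norm ?addr_ge0 ?lerDr ?invr_ge0 ?(ltW r0).
rewrite adde0 /= lee_fin !ger0_norm ?invr_ge0 ?(ltW r0)//.
have vv0 : v <= v0.
  rewrite leNgt; apply: contra vin => v0v; rewrite inE/= in_itv/= v0v.
  by case/andP: vab.
apply: le_trans (_ : (rho v)^-1 <= _).
  by rewrite ler_piMl// invr_ge0 ltW.
rewrite lef_pV2 ?posrE//; apply: (rho_decr _ _ _ hlambda hp) => //.
by case/andP: vab.
Qed.

Lemma PhiqE : exists e : R -> R,
  [/\ forall v, 0 < v < ph -> 0 < e v <= 1,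
      primitive_oo R 0 ph e (fun v => - (1 * (gam v * e v))),
      e v @[v --> ph^'-] --> 0,
      leb.-integrable `]0, ph[ (EFin \o (fun v => e v / rho v))
    & forall x, Phiq lambda mu p r q x =
        (q * moment R `]0, ph[ (fun v => e v / rho v) x)%:E].
Proof.
have [e [e1 eE de elim iK]] := Phi_kernel; exists e; split => // x.
have mab : @measurable _ (measurableTypeR R) `]0, ph[%classic by exact: measurable_itv.
rewrite /Phiq EFinM; congr (_ * _)%E.
have D01 v : `]0, ph[%classic v -> 0 < v < 1 by rewrite /= in_itv/=; exact: in01.
rewrite /moment /Rintegral fineK; last first.
  by apply: integrable_fin_num => //; exact: (integrable_moment _ _ _ mab D01 iK).
apply: eq_integral => v /set_mem/=; rewrite in_itv/= => vab.
by rewrite eE// -EFinM mulrA.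
Qed.

Lemma Phiq_resolvent (e : R -> R) (x : nat) : (0 < x)%N ->
  (forall v, 0 < v < ph -> 0 < e v <= 1) ->
  primitive_oo R 0 ph e (fun v => - (1 * (gam v * e v))) ->
  e v @[v --> ph^'-] --> 0 ->
  leb.-integrable `]0, ph[ (EFin \o (fun v => e v / rho v)) ->
  (q + lambda * x%:R + mu) * moment _ `]0, ph[ (fun v => e v / rho v) x =
  jump_op _ lambda mu p r (moment _ `]0, ph[ (fun v => e v / rho v)) x.
Proof.
move=> x0 e1 de elim iK; apply/eqP; rewrite -subr_eq0; apply/eqP.
rewrite (resolvent_kernel _ _ _ _ _ _ hlambda hp hr 0 ph 1 e x 0 0) ?subrr ?mulr0 ?oppr0//.
- by rewrite mulr1.
- by move=> v vab; rewrite mul1r (rho_lt_phi _ _ _ hp).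
- by move=> v /e1/andP[/ltW].
- have lim : v ^+ x @[v --> (0 : R)^'+] --> (0 : R).
    have E : (0 : R) ^+ x = 0 by rewrite expr0n gtn_eqF.
    by rewrite -[X in _ --> X]E; apply: cvg_at_right_filter; exact: exprn_continuous.
  apply: (squeeze_cvgr _ (@cvg_cst _ (0 : R) _ _ _) lim).
  near=> v; have v0 : 0 < v by near: v; exact: nbhs_right_gt.
  have vp : v < ph by near: v; exact: nbhs_right_lt.
  have /andP[/ltW ev0 ev1] := e1 v (introT andP (conj v0 vp)).
  by rewrite mulr_ge0 ?exprn_ge0 ?(ltW v0)// ler_piMl// exprn_ge0// ltW.
- rewrite -(mul0r (ph ^+ x)); apply: cvgM => //.
  by apply: cvg_at_left_filter; exact: exprn_continuous.
Unshelve. all: by end_near. Qed.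
End Phi.

(** * The kernel above the fixed point *)

Section JumpOp.
Variables (R : realType) (lambda mu : R) (p : nat -> R) (r : int -> R).
Hypotheses (hlambda : 0 < lambda) (hmu : 0 <= mu).
Hypotheses (hp : offspring_law p) (hr : immigration_law r).
Local Notation H := (jump_op R lambda mu p r).

Let p_ge0 : forall k, 0 <= p k. Proof. by case: hp. Qed.
Let p_sum : series p @ \oo --> (1 : R). Proof. by case: hp. Qed.
Let rn_ge0 (k : nat) : 0 <= r k%:Z. Proof. by case: hr. Qed.
Let r_sum := immigration_sum _ _ hr.

Lemma cvg_series_bounded_mul (c f : nat -> R) (S M : R) :
  (forall k, 0 <= c k) -> series c @ \oo --> S -> (forall k, `|f k| <= M) ->
  cvgn (series (fun k => c k * f k)).
Proof.
move=> c0 cS fM; apply: normed_cvg.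
apply: (@series_le_cvg _ _ (fun k => M * c k)).
- by move=> n; exact: normr_ge0.
- by move=> n; rewrite mulr_ge0// (le_trans (normr_ge0 _) (fM 0%N)).
- by move=> n; rewrite /= normrM mulrC (ger0_norm (c0 n)) ler_wpM2r.
have := @is_cvg_seriesZ R c M; apply; apply/cvg_ex; exists S; exact: cS.
Qed.

Lemma lim_series_affine (c f : nat -> R) (S M a b : R) :
  (forall k, 0 <= c k) -> series c @ \oo --> S -> (forall k, `|f k| <= M) ->
  limn (series (fun k => c k * (a - b * f k))) =
  a * S - b * limn (series (fun k => c k * f k)).
Proof.
move=> c0 cS fM; apply/cvg_lim => //.
have cf := cvg_series_bounded_mul _ _ _ _ c0 cS fM.
rewrite (_ : series _ = fun n => a * series c n - b * series (fun k => c k * f k) n).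
  by apply: cvgB; apply: cvgMl_tmp.
apply/funext => n; rewrite !seriesEnat/= !mulr_sumr -sumrB.
by apply: eq_bigr => k _; ring.
Qed.

Lemma jump_op_affine (f : nat -> R) (M a b : R) x : (forall k, `|f k| <= M) ->
  H (fun y => a - b * f y) x = a * (lambda * x%:R + mu) - b * H f x.
Proof.
move=> fM; rewrite /jump_op.
rewrite (lim_series_affine p (fun k => f (x + k - 1)%N) 1 M)//.
rewrite (lim_series_affine (fun k : nat => r k%:Z) (fun k => f (x + k)%N) (1 - r (-1)) M)//.
ring.
Qed.

Lemma jump_op_cst (a : R) x : H (fun=> a) x = a * (lambda * x%:R + mu).
Proof.
have := jump_op_affine (fun=> 0) 0 a 0 x; rewrite !mul0r !subr0 => <-//.
by move=> k; rewrite normr0.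
Qed.
End JumpOp.

Section Psi.
Variables (R : realType) (lambda mu : R) (p : nat -> R) (r : int -> R) (q : R).
Hypotheses (hlambda : 0 < lambda) (hmu : 0 <= mu).
Hypotheses (hp : offspring_law p) (hr : immigration_law r) (hq : 0 < q).
Local Notation leb := (@lebesgue_measure R).
Local Notation C := (immigration_rate R mu r q).
Local Notation rho := (rho lambda p).
Local Notation gam := (gammaq lambda mu p r q).
Local Notation zq := (phiq mu r q).
Local Notation ph := (phi p).

Hypotheses (zph : zq < ph) (ph1 : ph < 1).
Variables (G : R -> R) (M : R).
Hypotheses (dG : primitive_oo R ph 1 G gam) (GM : forall v, ph < v < 1 -> G v <= M).

Let ph0 : 0 < ph. Proof. by case: (phi_spec _ _ hp). Qed.

Let in01 v : ph < v < 1 -> 0 < v < 1.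
Proof. by move=> /andP[pv ->]; rewrite (lt_trans _ pv). Qed.

Let nph v : ph < v < 1 -> v != ph.
Proof. by move=> /andP[pv _]; rewrite gt_eqF. Qed.

Let cgam : continuous_oo R ph 1 gam.
Proof.
by move=> v vab; apply: (gammaq_continuous _ _ _ _ _ _ hlambda hp hr); [exact: in01|exact: nph].
Qed.

Let gam0 v : ph < v < 1 -> 0 < gam v.
Proof.
move=> vab; apply: (gammaq_gt0 _ _ _ _ _ _ hlambda hmu hp hr hq); last exact: nph.
by case/andP: vab => pv ->; rewrite (lt_trans zph).
Qed.

(** At [phi] the exponent tends to minus infinity logarithmically; at 1 it has a finite
    limit, being monotone and bounded, and [e] is normalised by this limit. *)
Lemma Psi_kernel : exists e : R -> R,
  [/\ forall v, ph < v < 1 -> 0 < e v,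
      forall v, ph < v < 1 -> expeR (- oriented_integral gam v 1) = (e v)%:E,
      primitive_oo R ph 1 e (fun v => - (-1 * (gam v * e v))),
      e v @[v --> ph^'+] --> 0 /\ e v @[v --> (1 : R)^'-] --> (1 : R)
    & leb.-integrable `]ph, 1[ (EFin \o (fun v => e v / rho v))].
Proof.
have mono u v : ph < u -> u <= v -> v < 1 -> G u <= G v.
  by move=> pu uv v1; apply: (primitive_oo_le _ _ _ _ _ _ _ dG) => // w /gam0/ltW.
have /cvg_ex[/= l Gl] : cvg (G x @[x --> (1 : R)^'-]).
  apply: nondecreasing_at_left_is_cvgr.
    near=> y => u v; rewrite !in_itv/= => /andP[yu u1] /andP[yv v1] uv.
    by apply: mono => //; apply: lt_trans yu; near: y; exact: nbhs_left_gt.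
  near=> y; exists M => _ [v /= + <-]; rewrite in_itv/= => /andP[yv v1].
  by apply: GM; rewrite v1 andbT; apply: lt_trans yv; near: y; exact: nbhs_left_gt.
have oiE v : ph < v < 1 -> oriented_integral gam v 1 = (l - G v)%:E.
  move=> /andP[pv v1]; rewrite /oriented_integral (ltW v1).
  have dGv : primitive_oo R v 1 G gam by apply: primitive_oo_sub dG => //; exact: ltW.
  have cgv : continuous_oo R v 1 gam by apply: continuous_oo_sub cgam => //; exact: ltW.
  apply: (ge0_integral_primitive_cvg _ _ _ v1 _ _ _ _ dGv cgv _ Gl).
    apply: cvg_at_right_filter; apply: (primitive_oo_continuous _ _ _ _ _ dG).
    by rewrite v1 pv.
  by move=> x /andP[vx x1]; apply/ltW/gam0; rewrite x1 (lt_trans pv).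
pose e v := expR (G v - l); exists e.
have de : primitive_oo R ph 1 e (fun v => - (-1 * (gam v * e v))).
  move=> v vab; have dGl := primitive_oo_addC _ _ _ l _ _ dG v vab.
  have := @is_derive1_comp R (@expR R) (fun v => G v - l) v _ _ (is_derive_expR _) dGl.
  by rewrite mulN1r opprK mulrC.
have [c c0 hc] : exists2 c, 0 < c & forall v, ph <= v < 1 -> c <= C v.
  by apply: (immigration_rate_min _ _ _ _ hmu hr hq); rewrite zph.
have e0 : e v @[v --> ph^'+] --> 0.
  have hk : 0 < c / lambda by rewrite divr_gt0.
  rewrite -(mul0r (expR (- l))).
  rewrite (_ : e = fun v => expR (G v) * expR (- l)); last first.
    by apply/funext => v; rewrite /e expRD.
  apply: cvgMr_tmp; apply: (expR_primitive_at_right _ _ _ _ _ _ ph1 hk dG).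
  move=> x xab; have /andP[px x1] := xab.
  have r0 : 0 < rho x by rewrite (rho_gt0 _ _ _ hlambda hp) ?in01 ?nph.
  have px0 : 0 < x - ph by rewrite subr_gt0.
  rewrite gammaqE ler_pdivrMr// mulrAC ler_pdivlMr//.
  apply: le_trans (_ : c / lambda * (lambda * (x - ph)) <= _).
    by rewrite ler_wpM2l ?(ltW hk)// (rho_le_right _ _ _ hlambda hp).
  by rewrite mulrA divfK ?gt_eqF// ler_wpM2r ?(ltW px0)// hc// x1 ltW.
have e1 : e v @[v --> (1 : R)^'-] --> (1 : R).
  have Gl0 : G v - l @[v --> (1 : R)^'-] --> l - l by apply: cvgB => //; exact: cvg_cst.
  have E : (1 : R) = expR (l - l) by rewrite subrr expR0.
  rewrite [X in _ --> X]E.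
  exact: (continuous_cvg _ (@continuous_expR R (l - l)) Gl0).
split=> //.
- by move=> v vab; exact: expR_gt0.
- by move=> v vab; rewrite oiE// -EFinN opprB.
apply: (kernel_integrable _ _ mu _ _ q hlambda hp hr _ _ (-1) _ 0 1 c _ ph1) => //.
- exact: ltW.
- by rewrite mulrNN mulr1.
- by move=> v _; exact: expR_ge0.
- by move=> v /andP[/ltW pv v1]; rewrite hc// pv.
Unshelve. all: by end_near. Qed.

(** The boundary terms of the mixture are 0 at [phi] and 1 at 1; the latter cancels the
    defect [(q - Q) 1 = q] of the constant function. *)
Lemma Psiq_resolvent : exists f : nat -> R,
  [/\ forall x, 0 <= f x <= f 0%N, f @ \oo --> 0,
      forall x, Psiq lambda mu p r q x = (1 - q * f x)%:E
    & forall x, (0 < x)%N -> (q + lambda * x%:R + mu) * f x - jump_op _ lambda mu p r f x = 1].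
Proof.
have [e [e_gt0 eE de [e0 e1] iK]] := Psi_kernel.
have mab : @measurable _ (measurableTypeR R) `]ph, 1[%classic by exact: measurable_itv.
have D01 v : `]ph, 1[%classic v -> 0 < v < 1 by rewrite /= in_itv/=; exact: in01.
have K0 v : `]ph, 1[%classic v -> 0 <= e v / rho v.
  rewrite /= in_itv/= => vab; rewrite divr_ge0 ?(ltW (e_gt0 _ vab))//.
  by rewrite ltW// (rho_gt0 _ _ _ hlambda hp) ?in01 ?nph.
exists (moment R `]ph, 1[ (fun v => e v / rho v)); split.
- by move=> x; rewrite (moment_ge0 _ _ _ D01 K0) (moment_le _ _ _ mab D01 K0 iK).
- exact: (moment_cvg0 _ _ _ mab D01 K0 iK).
- move=> x; rewrite /Psiq EFinB EFinM; congr (_ - _ * _)%E.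
  rewrite /moment /Rintegral fineK; last first.
    by apply: integrable_fin_num => //; exact: (integrable_moment _ _ _ mab D01 iK).
  apply: eq_integral => v /set_mem/=; rewrite in_itv/= => vab.
  by rewrite eE// -EFinM mulrA.
move=> x x0.
rewrite (resolvent_kernel _ _ _ _ _ _ hlambda hp hr ph 1 (-1) e x 0 1)//.
- by rewrite subr0 mulr1 opprK.
- exact: ltW.
- by rewrite mulrNN mulr1.
- by move=> v vab; rewrite mulN1r (rho_gt_phi _ _ _ hp)// opprK.
- by move=> v /e_gt0/ltW.
- rewrite -(mul0r (ph ^+ x)); apply: cvgM => //.
  by apply: cvg_at_right_filter; exact: exprn_continuous.
- rewrite -[X in _ --> X](mul1r 1) -{3}(expr1n R x); apply: cvgM => //.
  by apply: cvg_at_left_filter; exact: exprn_continuous.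
Qed.
End Psi.

(** * Discounting an exponential holding time *)

Section LaplaceCoordinate.
Variables (R : realType) (q : R).
Hypothesis hq : 0 < q.
Local Notation leb := (@lebesgue_measure R).

Lemma measurable_bool_natr d (T : measurableType d) (b : T -> bool) :
  measurable_fun setT b -> measurable_fun setT (fun w => (b w)%:R : R).
Proof.
move=> mb; apply: (measurableT_comp (f := fun c : bool => c%:R : R)) mb.
by [].
Qed.

(** The indicator makes the discount [exp (- q s)] vanish for an infinite [s], where
    [fine] returns 0. *)
Definition discount (s : \bar R) : R := (s < +oo)%E%:R * expR (- (q * fine s)).

Lemma discount_fin (s : R) : discount s%:E = expR (- (q * s)).
Proof. by rewrite /discount ltry mul1r. Qed.

Lemma discount_pinfty : discount +oo%E = 0.
Proof. by rewrite /discount ltxx mul0r. Qed.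

Lemma discount_bounds (s : \bar R) : (0 < s)%E -> 0 <= discount s <= 1.
Proof.
case: s => [s|_|//]; last by rewrite discount_pinfty lexx ler01.
rewrite lte_fin discount_fin => s0; rewrite expR_ge0/= expR_le1.
by rewrite oppr_le0 mulr_ge0 ?ltW.
Qed.

Lemma cvg_expR_scale (k : R) : 0 < k -> expR (- (k * t)) @[t --> +oo] --> 0.
Proof.
move=> k0; have h : k * t @[t --> +oo] --> +oo by exact: gt0_cvgMry.
exact: (cvg_comp _ _ h (@cvgr_expR R)).
Qed.

Lemma is_derive_expR_scale (k t : R) :
  is_derive t 1 (fun x => expR (- (k * x))) (- (k * expR (- (k * t)))).
Proof.
have dk : is_derive t 1 (fun x : R => - (k * x)) (- k).
  have := is_deriveN (is_deriveZ k (is_derive_id t (1 : R))).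
  by rewrite /GRing.scale/= mulr1.
have := @is_derive1_comp R (@expR R) _ t _ _ (is_derive_expR _) dk.
by rewrite mulrN mulrC.
Qed.

Lemma continuous_expR_scale (k : R) : continuous (fun t : R => expR (- (k * t))).
Proof.
move=> t; apply: continuous_comp; last exact: continuous_expR.
by apply: cvgN; apply: cvgMl_tmp; exact: cvg_id.
Qed.

Lemma measurable_discount d (T : measurableType d) (S : T -> \bar R) :
  measurable_fun setT S -> measurable_fun setT (fun w => discount (S w)).
Proof.
move=> mS; apply: measurable_funM.
  by apply: measurable_bool_natr; exact: measurable_fun_lte.
apply: (measurableT_comp (f := fun x : R => expR (- (q * x)))).
  by apply: continuous_measurable_fun; exact: continuous_expR_scale.
by apply: (measurableT_comp (f := @fine R)) mS; exact: fine_measurable.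
Qed.

Lemma integral_exp_tail (s : R) :
  (\int[leb]_(t in `[s, +oo[) (q * expR (- (q * t)))%:E = (expR (- (q * s)))%:E)%E.
Proof.
rewrite (@ge0_continuous_FTC2y R _ (fun t => - expR (- (q * t))) s 0).
- by rewrite -EFinB sub0r opprK.
- by move=> x _; rewrite mulr_ge0 ?expR_ge0 ?ltW.
- apply: continuous_subspaceT => t; apply: cvgMl_tmp; exact: continuous_expR_scale.
- by rewrite -oppr0; apply: cvgN; exact: cvg_expR_scale.
- by move=> x _; have [] := is_deriveN (is_derive_expR_scale q x).
- by apply: cvg_at_right_filter; apply: cvgN; exact: continuous_expR_scale.
- move=> x _; rewrite derive1E; have [_ ->] := is_deriveN (is_derive_expR_scale q x).
  by rewrite opprK.
Qed.

Lemma integral_exp_survival (k K : R) : 0 <= k -> 0 <= K ->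
  (\int[leb]_(t in `[0%R, +oo[) ((K - K * expR (- (k * t))) * (q * expR (- (q * t))))%:E
   = (K * (k / (q + k)))%:E)%E.
Proof.
move=> k0 K0; have qk : 0 < q + k by rewrite ltr_pwDl.
pose F t := K * (q / (q + k) * expR (- ((q + k) * t)) - expR (- (q * t))).
have dF (t : R) : is_derive t 1 F ((K - K * expR (- (k * t))) * (q * expR (- (q * t)))).
  have := is_deriveZ K (is_deriveB (is_deriveZ (q / (q + k)) (is_derive_expR_scale (q + k) t))
    (is_derive_expR_scale q t)).
  rewrite /GRing.scale/=.
  have -> : K * (q / (q + k) * - ((q + k) * expR (- ((q + k) * t))) - - (q * expR (- (q * t)))) =
    (K - K * expR (- (k * t))) * (q * expR (- (q * t))); last exact.
  have -> : expR (- ((q + k) * t)) = expR (- (k * t)) * expR (- (q * t)).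
    by rewrite -expRD; congr expR; ring.
  by field; rewrite gt_eqF.
rewrite (@ge0_continuous_FTC2y R _ F 0 0).
- rewrite -EFinB /F !mulr0 oppr0 expR0; congr EFin; field.
  by rewrite gt_eqF.
- move=> x x0; rewrite mulr_ge0 ?mulr_ge0 ?expR_ge0 ?(ltW hq)//.
  by rewrite subr_ge0 ler_piMr// expR_le1 oppr_le0 mulr_ge0.
- apply: continuous_subspaceT => t; apply: cvgM.
    apply: cvgB; first exact: cvg_cst.
    by apply: cvgMl_tmp; exact: continuous_expR_scale.
  by apply: cvgMl_tmp; exact: continuous_expR_scale.
- rewrite -(mulr0 K); apply: cvgMl_tmp; rewrite -[X in _ --> X](subr0 0).
  apply: cvgB; last exact: cvg_expR_scale.
  by rewrite -(mulr0 (q / (q + k))); apply: cvgMl_tmp; exact: cvg_expR_scale.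
- by move=> x _; have [] := dF x.
- apply: cvg_at_right_filter; apply: differentiable_continuous.
  by apply/derivable1_diffP; have [] := dF 0.
- by move=> x _; rewrite derive1E; have [_ ->] := dF x.
Qed.

(** If, on the weighted event described by [Z], the holding time [S] is
    exponential with rate [k], then discounting over [S] multiplies the total
    weight by [k / (q + k)]: write [exp (- q S)] as the integral of
    [q exp (- q t)] over [t >= S] and exchange the integrals. *)
Lemma laplace_coordinate d (T : measurableType d) (P : probability T R)
    (Z : T -> R) (S : T -> \bar R) (k K : R) :
  0 <= k -> 0 <= K ->
  measurable_fun setT Z -> (forall w, 0 <= Z w <= 1) ->
  measurable_fun setT S -> (forall w, (0 < S w)%E) ->
  (forall t, 0 <= t ->
    (\int[P]_w (Z w * (t%:E < S w)%E%:R)%:E = (K * expR (- (k * t)))%:E)%E) ->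
  (\int[P]_w (Z w * discount (S w))%:E = (K * (k / (q + k)))%:E)%E.
Proof.
move=> k0 K0 mZ Z01 mS S0 law.
have qt0 t : 0 <= q * expR (- (q * t)) by rewrite mulr_ge0 ?expR_ge0 ?ltW.
have Z0 w : 0 <= Z w by case/andP: (Z01 w).
pose f (z : T * measurableTypeR R) :=
  (Z z.1 * (S z.1 <= z.2%:E)%E%:R * (q * expR (- (q * z.2))))%:E.
have mf : measurable_fun setT f.
  apply/measurable_EFinP; apply: measurable_funM.
    apply: measurable_funM; first exact: measurableT_comp.
    apply: measurable_bool_natr; apply: measurable_fun_lee.
      exact: measurableT_comp.
    by apply/measurable_EFinP; exact: measurable_snd.
  apply: (measurableT_comp (f := fun t : R => q * expR (- (q * t)))); last exact: measurable_snd.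
  apply: continuous_measurable_fun => t; apply: cvgMl_tmp; exact: continuous_expR_scale.
have f0 z : (0 <= f z)%E by rewrite lee_fin; apply: mulr_ge0 => //; apply: mulr_ge0; rewrite ?ler0n.
have := @fubini_tonelli _ _ T (measurableTypeR R) R P leb f mf f0.
have -> : (\int[P]_w \int[leb]_t f (w, t) = \int[P]_w (Z w * discount (S w))%:E)%E.
  apply: eq_integral => w _.
  have := S0 w; rewrite /f /=; case: (S w) => [s|_|//]; last first.
    have -> : (Z w * discount +oo%E)%:E = 0%E by rewrite discount_pinfty mulr0.
    apply: integral0_eq => t _.
    by rewrite leye_eq /= mulr0 mul0r.
  move=> s0; rewrite discount_fin EFinM -integral_exp_tail -ge0_integralZl//; last 3 first.
  - apply/measurable_EFinP; apply: measurable_funTS.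
    apply: continuous_measurable_fun => t; apply: cvgMl_tmp; exact: continuous_expR_scale.
  - by move=> t _; rewrite lee_fin.
  - by rewrite lee_fin.
  rewrite [RHS]integral_mkcond; apply: eq_integral => t _.
  rewrite /patch lee_fin; case: ifPn => tin.
    have -> : s <= t by move: tin; rewrite inE/= in_itv/= andbT.
    by rewrite mulr1 EFinM.
  have -> : (s <= t) = false.
    by apply/negbTE; apply: contra tin => st; rewrite inE/= in_itv/= st.
  by rewrite mulr0 mul0r.
move=> ->.
rewrite -(integral_exp_survival _ _ k0 K0) [RHS]integral_mkcond.
apply: eq_integral => t _; rewrite /patch /f /=; case: ifPn => tin; last first.
  apply: integral0_eq => w _.
  have -> : (S w <= t%:E)%E = false; last by rewrite mulr0 mul0r.
  apply/negbTE; rewrite -ltNge; apply: lt_trans (S0 w); rewrite lte_fin ltNge.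
  by apply: contra tin => t0; rewrite inE/= in_itv/= t0.
have t0 : 0 <= t by move: tin; rewrite inE/= in_itv/= andbT.
have EZ : (\int[P]_w (Z w)%:E = K%:E)%E.
  have := law 0 (lexx _); rewrite mulr0 oppr0 expR0 mulr1 => <-.
  by apply: eq_integral => w _; rewrite S0 mulr1.
have mb : measurable_fun setT (fun w => (t%:E < S w)%E%:R : R).
  by apply: measurable_bool_natr; apply: measurable_fun_lte.
have iZ : P.-integrable setT (EFin \o Z).
  apply/integrableP; split; first exact/measurable_EFinP.
  rewrite (_ : (\int[P]_w `|(EFin \o Z) w| = K%:E)%E) ?ltry// -EZ.
  by apply: eq_integral => w _; rewrite /= ger0_norm.
have iZt : P.-integrable setT (EFin \o (fun w => Z w * (t%:E < S w)%E%:R)).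
  apply: le_integrable iZ => //.
    by apply/measurable_EFinP; exact: measurable_funM.
  move=> w _; rewrite /= lee_fin normrM ler_piMr// ger0_norm ?ler0n//.
  by case: (_ < _)%E.
rewrite EFinM EFinB -(law t t0) -EZ -(integralB_EFin measurableT iZ iZt) muleC.
rewrite -ge0_integralZl//; last 3 first.
- apply/measurable_EFinP; apply: measurable_funB => //; exact: measurable_funM.
- move=> w _; rewrite -EFinB lee_fin subr_ge0 ler_piMr//.
  by case: (_ < _)%E.
- by rewrite lee_fin.
apply: eq_integral => w _; rewrite -EFinB -EFinM; congr EFin.
by rewrite leNgt; case: (_ < _)%E => /=; rewrite ?mulr0 ?mulr1 ?subrr ?subr0 ?mul0r ?mulr0// mulrC.
Qed.
End LaplaceCoordinate.

(** * Laplace transforms of jump times *)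

Section Chain.
Variables (R : realType) (d : measure_display) (T : measurableType d).
Variables (Q : nat -> nat -> R) (P : nat -> probability T R).
Variables (Y : nat -> T -> nat) (S : nat -> T -> \bar R) (q : R).
Hypotheses (hq : 0 < q) (rate_ge0 : forall i, 0 <= rate Q i).
Hypothesis jump_ge0 : forall i j, 0 <= jump_matrix Q i j.
Hypotheses (mY : forall n, measurable_fun setT (Y n)) (mS : forall n, measurable_fun setT (S n)).
Hypothesis S_gt0 : forall n w, (0 < S n w)%E.
Hypothesis law : forall (x n : nat) (y : nat -> nat) (t : nat -> R),
  (forall i, 0 <= t i) ->
  P x [set w | forall i, (i <= n)%N -> Y i w = y i /\ ((t i)%:E < S i w)%E] =
  ((y 0%N == x)%:R
   * (\prod_(i < n) jump_matrix Q (y i) (y i.+1))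
   * \prod_(i < n.+1) expR (- (rate Q (y i) * t i)))%:E.

Local Notation J := (jump_matrix Q).

(** The Laplace transform at [q] of the holding time in state [i]. *)
Definition holding_laplace (i : nat) : R := rate Q i / (q + rate Q i).

Local Notation kap := holding_laplace.

Lemma holding_laplace_ge0 i : 0 <= kap i.
Proof. by rewrite divr_ge0// addr_ge0// ltW. Qed.

Definition on_path (k : nat) (y : nat -> nat) (w : T) : R :=
  \prod_(i < k.+1) (Y i w == y i)%:R.

Lemma on_path_bounds k y w : 0 <= on_path k y w <= 1.
Proof.
rewrite /on_path prodr_ge0 => [|i _]; last exact: ler0n.
by apply: prodr_ile1 => i _; rewrite ler0n; case: (_ == _); rewrite ?lexx ?ler01.
Qed.

Lemma measurable_visit i j : measurable_fun setT (fun w => (Y i w == j)%:R : R).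
Proof.
by apply: (measurableT_comp (f := fun n : nat => (n == j)%:R : R)) (mY i).
Qed.

Lemma measurable_on_path k y : measurable_fun setT (on_path k y).
Proof. by apply: measurable_prod => i _; exact: measurable_visit. Qed.

Definition path_weight (x n : nat) (y : nat -> nat) : R :=
  (y 0%N == x)%:R * \prod_(i < n) J (y i) (y i.+1).

Lemma path_weight_ge0 x n y : 0 <= path_weight x n y.
Proof. by rewrite mulr_ge0// prodr_ge0. Qed.

(** Along a given path the holding times are independent, so they can be
    discounted one after the other. *)
Lemma laplace_path_mixed (x n : nat) (y : nat -> nat) m (t : nat -> R) :
  (m <= n.+1)%N -> (forall i, 0 <= t i) ->
  (\int[P x]_w (on_path n y w * \prod_(i < n.+1)
     (if (i < m)%N then discount R q (S i w) else ((t i)%:E < S i w)%E%:R))%:E =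
  (path_weight x n y * \prod_(i < n.+1)
     (if (i < m)%N then kap (y i) else expR (- (rate Q (y i) * t i))))%:E)%E.
Proof.
elim: m t => [|m IH] t mn t0.
  rewrite /path_weight -(law x n y t t0).
  set A := [set w | _].
  have indE w : (on_path n y w * \prod_(i < n.+1) ((t i)%:E < S i w)%E%:R)%:E = (\1_A w)%:E.
    rewrite /on_path -big_split/= indicE; congr EFin.
    have [wA|wA] := boolP (w \in A).
      rewrite big1// => i _; have [e1 e2] := set_mem wA i (ltn_ord i).
      by rewrite e1 eqxx e2 mulr1.
    apply/eqP; rewrite prodf_seq_eq0; apply: contraNT wA => /hasPn h.
    rewrite inE => i ilt; have := h (Ordinal (ilt : (i < n.+1)%N)).
    rewrite mem_index_enum => /(_ isT) /=.
    case: (Y i w =P y i) => [->|_]; last by rewrite mul0r eqxx.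
    by case: (_ < _)%E => //; rewrite mulr0 eqxx.
  have mA : measurable A.
    have -> : A = \bigcap_(i in `I_n.+1) (Y i @^-1` [set y i] `&` [set w | ((t i)%:E < S i w)%E]).
      by apply/seteqP; split=> v h i /=; have := h i.
    apply: bigcap_measurable => //; first by exists 0%N.
    move=> i _; apply: measurableI; first by rewrite -[X in measurable X]setTI; exact: mY.
    by rewrite -[X in measurable X]setTI; exact: measurable_lte.
  by under eq_integral do rewrite indE; rewrite integral_indic// setIT.
pose o := Ordinal (mn : (m < n.+1)%N).
pose g (k : nat) (u : nat -> R) i w := if (i < k)%N then discount R q (S i w) else ((u i)%:E < S i w)%E%:R : R.
pose Z w := on_path n y w * \prod_(i < n.+1 | i != o) g m t i w.
pose h (u : nat -> R) (k : nat) i := if (i < k)%N then kap (y i) else expR (- (rate Q (y i) * u i)).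
pose K := path_weight x n y * \prod_(i < n.+1 | i != o) h t m i.
have nem (i : 'I_n.+1) : i != o -> (i < m.+1)%N = (i < m)%N.
  move=> io; rewrite ltnS leq_eqVlt; case: eqP => // im.
  by move: io; rewrite (_ : i = o) ?eqxx//; exact: val_inj.
have -> : (path_weight x n y * \prod_(i < n.+1) h t m.+1 i)%:E = (K * (rate Q (y m) / (q + rate Q (y m))))%:E.
  congr EFin; rewrite (bigD1 o)//= /K -[RHS]mulrA [h _ _ _ * _]mulrC; congr (_ * (_ * _)).
    by apply: eq_bigr => i io; rewrite /h nem.
  by rewrite /h ltnSn.
have ZE w : on_path n y w * \prod_(i < n.+1) g m.+1 t i w = Z w * discount R q (S m w).
  rewrite (bigD1 o)//= /Z -[RHS]mulrA [g _ _ _ _ * _]mulrC; congr (_ * (_ * _)).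
    by apply: eq_bigr => i io; rewrite /g nem.
  by rewrite /g ltnSn.
under eq_integral do rewrite ZE.
have g01 k u i w : 0 <= g k u i w <= 1.
  rewrite /g; case: ifP => _; first exact: discount_bounds.
  by rewrite ler0n; case: (_ < _)%E; rewrite ?lexx ?ler01.
have h0 u k i : 0 <= h u k i.
  by rewrite /h; case: ifP => _; [exact: holding_laplace_ge0|exact: expR_ge0].
apply: (laplace_coordinate R q hq) => //.
- by rewrite mulr_ge0 ?path_weight_ge0// prodr_ge0.
- apply: measurable_funM; first exact: measurable_on_path.
  under eq_fun do rewrite -big_filter.
  apply: measurable_prod => i _; rewrite /g; case: (i < m)%N.
    exact: measurable_discount.
  by apply: measurable_bool_natr; exact: measurable_fun_lte.
- move=> w; have /andP[p0 p1] := on_path_bounds n y w.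
  have G0 : 0 <= \prod_(i < n.+1 | i != o) g m t i w.
    by apply: prodr_ge0 => i _; case/andP: (g01 m t i w).
  rewrite /Z mulr_ge0//= mulr_ile1//.
  by apply: prodr_ile1 => i _; exact: g01.
move=> s s0; pose u i := if i == m then s else t i.
have u0 i : 0 <= u i by rewrite /u; case: ifP.
have uo (i : 'I_n.+1) : i != o -> u i = t i.
  move=> io; rewrite /u; case: eqP => // im.
  by move: io; rewrite (_ : i = o) ?eqxx//; exact: val_inj.
have := IH u (ltnW mn) u0.
have -> : path_weight x n y * \prod_(i < n.+1) h u m i = K * expR (- (rate Q (y m) * s)).
  rewrite (bigD1 o)//= /K -[RHS]mulrA [h _ _ _ * _]mulrC; congr (_ * (_ * _)).
    by apply: eq_bigr => i io; rewrite /h uo.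
  by rewrite /h ltnn /u eqxx.
move=> <-; apply: eq_integral => w _; congr EFin.
rewrite [in RHS](bigD1 o)//= /Z -[LHS]mulrA [X in _ = _ * X]mulrC; congr (_ * (_ * _)).
  by apply: eq_bigr => i io; rewrite /g uo.
by rewrite ltnn /u eqxx.
Qed.

(** The discount over the holding times 0, ..., n, that is until jump number
    [n.+1]. *)
Definition total_discount (n : nat) (w : T) : R := \prod_(i < n.+1) discount R q (S i w).

Lemma total_discount_bounds n w : 0 <= total_discount n w <= 1.
Proof.
rewrite /total_discount prodr_ge0 => [|i _]; last by case/andP: (discount_bounds _ _ hq _ (S_gt0 i w)).
by apply: prodr_ile1 => i _; exact: discount_bounds.
Qed.

Lemma measurable_total_discount n : measurable_fun setT (total_discount n).
Proof. by apply: measurable_prod => i _; exact: measurable_discount. Qed.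

Lemma laplace_path (x n : nat) (y : nat -> nat) :
  (\int[P x]_w (on_path n y w * total_discount n w)%:E =
  (path_weight x n y * \prod_(i < n.+1) kap (y i))%:E)%E.
Proof.
have := laplace_path_mixed x n y n.+1 (fun=> 0) (leqnn _) (fun=> lexx _).
under [X in _ = (_ * X)%:E -> _]eq_bigr do rewrite ltn_ord.
move=> <-; apply: eq_integral => w _; congr (_ * _)%:E.
by apply: eq_bigr => i _; rewrite ltn_ord.
Qed.

(** The Laplace transform of the time of jump number [n.+1]. *)
Fixpoint jump_laplace (n x : nat) : \bar R :=
  if n is m.+1 then ((kap x)%:E * \sum_(j <oo) (J x j)%:E * jump_laplace m j)%E
  else (kap x)%:E.

Lemma jump_laplace_ge0 n x : (0 <= jump_laplace n x)%E.
Proof.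
elim: n x => [|n IH] x /=; first by rewrite lee_fin holding_laplace_ge0.
rewrite mule_ge0 ?lee_fin ?holding_laplace_ge0//.
by apply: nneseries_ge0 => j _ _; rewrite mule_ge0// lee_fin.
Qed.

Lemma nneseries_visit i w : (\sum_(j <oo) ((Y i w == j)%:R : R)%:E = 1)%E.
Proof.
rewrite (@nneseriesD1 _ _ (Y i w))//.
rewrite eqxx eseries0 ?adde0// => j _ /andP[_].
by rewrite eq_sym => /negbTE ->.
Qed.

(** Summing the last formula over the end of the path, one state at a time from the
    last one backwards, produces the recursion of [jump_laplace]. *)
Lemma laplace_partial_path (x n e k : nat) (y : nat -> nat) : (k + e = n)%N ->
  (\int[P x]_w (on_path k y w * total_discount n w)%:E =
  (path_weight x k y * \prod_(i < k) kap (y i))%:E * jump_laplace e (y k))%E.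
Proof.
elim: e k y => [|e IH] k y kn.
  rewrite -kn addn0 laplace_path big_ord_recr/= mulrA EFinM.
  done.
pose upd j i := if i == k.+1 then j else y i.
have updE j i : (i <= k)%N -> upd j i = y i.
  by move=> ik; rewrite /upd ltn_eqF.
have pathE j w : on_path k.+1 (upd j) w = on_path k y w * (Y k.+1 w == j)%:R.
  rewrite /on_path big_ord_recr/= {2}/upd eqxx; congr (_ * _).
  by apply: eq_bigr => i _; rewrite updE// -ltnS.
have -> : (\int[P x]_w (on_path k y w * total_discount n w)%:E =
   \int[P x]_w \sum_(j <oo) (on_path k.+1 (upd j) w * total_discount n w)%:E)%E.
  apply: eq_integral => w _.
  under eq_eseriesr do rewrite pathE mulrAC EFinM.
  rewrite nneseriesZl; last by move=> j _; rewrite lee_fin ler0n.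
  by rewrite nneseries_visit mule1.
rewrite integral_nneseries//; last 2 first.
- move=> j; apply/measurable_EFinP; apply: measurable_funM; first exact: measurable_on_path.
  exact: measurable_total_discount.
- move=> j w _; rewrite lee_fin mulr_ge0//; first by case/andP: (on_path_bounds k.+1 (upd j) w).
  by case/andP: (total_discount_bounds n w).
under eq_eseriesr do rewrite IH ?addSnnS//.
have wE j : ((path_weight x k.+1 (upd j) * \prod_(i < k.+1) kap (upd j i))%:E * jump_laplace e (upd j k.+1) =
    (path_weight x k y * \prod_(i < k) kap (y i) * kap (y k))%:E * ((J (y k) j)%:E * jump_laplace e j))%E.
  have u1 : upd j k.+1 = j by rewrite /upd eqxx.
  rewrite muleA -EFinM u1; congr (_%:E * _)%E.
  rewrite /path_weight !big_ord_recr/= u1 !updE//.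
  have -> : \prod_(i < k) J (upd j i) (upd j i.+1) = \prod_(i < k) J (y i) (y i.+1).
    by apply: eq_bigr => i _; rewrite !updE// ltnW.
  have -> : \prod_(i < k) kap (upd j i) = \prod_(i < k) kap (y i).
    by apply: eq_bigr => i _; rewrite updE// ltnW.
  ring.
under eq_eseriesr do rewrite wE.
rewrite nneseriesZl/=; last by move=> j _; rewrite mule_ge0 ?lee_fin ?jump_laplace_ge0.
by rewrite EFinM muleA.
Qed.

Lemma laplace_start x n :
  (\int[P x]_w ((Y 0%N w == x)%:R * total_discount n w)%:E = jump_laplace n x)%E.
Proof.
have := laplace_partial_path x n n 0 (fun=> x) (add0n n).
rewrite /path_weight eqxx !big_ord0 !mulr1 mul1e => <-.
by apply: eq_integral => w _; rewrite /on_path big_ord1.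
Qed.
End Chain.

(** * A criterion for non-explosion *)

Section NonExplosion.
Variables (R : realType) (d : measure_display) (T : measurableType d).
Variables (Q : nat -> nat -> R) (P : nat -> probability T R) (X : R -> T -> option nat) (q : R).
Hypotheses (hq : 0 < q) (rate_ge0 : forall i, 0 <= rate Q i).
Hypothesis jump_ge0 : forall i j, 0 <= jump_matrix Q i j.

(** All holding times are finite here, since their sum is. *)
Lemma expR_le_discount (S : nat -> T -> \bar R) (w : T) n (t : R) :
  (forall i, (0 < S i w)%E) -> (jump_time S n w <= t%:E)%E ->
  expR (- (q * t)) <= \prod_(i < n) discount R q (S i w).
Proof.
move=> S0; elim: n t => [|n IH] t.
  rewrite /jump_time !big_ord0 lee_fin => t0.
  by rewrite expR_le1 oppr_le0 mulr_ge0 // ltW.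
rewrite /jump_time !big_ord_recr/=; have := S0 n; case: (S n w) => [s|_|//].
  move=> _; rewrite -leeBrDr// -EFinB => /IH; rewrite discount_fin => h.
  rewrite -(subrK s t) mulrDr opprD expRD ler_wpM2r ?expR_ge0//.
rewrite addey ?leye_eq//.
by rewrite gt_eqF// (lt_le_trans (ltNyr 0))// sume_ge0// => i _; exact: ltW.
Qed.

(** On the event that all jump times are at most [M], each total discount is at
    least [exp (- q M)], so Markov's inequality bounds its probability. *)
Lemma not_explosive_laplace : minimal_ctmc Q P X ->
  (forall x e, (0 < x)%N -> 0 < e -> exists n, (jump_laplace R Q q n x <= e%:E)%E) ->
  ~ explosive P X.
Proof.
move=> [Y [S [[mY mS] S0 hSome hNone law]]] hL [x [x0]].
pose B (m : nat) := [set w | forall n, (jump_time S n w <= m%:R%:E)%E].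
have jt0 w : jump_time S 0 w = 0%E by rewrite /jump_time big_ord0.
have lifeE : [set w | (lifetime X w < +oo)%E] = \bigcup_m B m.
  apply/seteqP; split=> [w /=|w [m _ Bm] /=]; last first.
    apply: le_lt_trans (ltry m%:R); apply: ereal_inf_lbound.
    by exists m%:R => //; split; [exact: ler0n|exact: hNone].
  move=> life; have [t [t0 Xt]] : exists t : R, 0 <= t /\ X t w = None.
    apply: contrapT => noT; move: life; rewrite /lifetime.
    rewrite (_ : [set _ | _ in _] = set0) ?ereal_inf0 ?ltxx//.
    by apply/seteqP; split=> // z [t [t0 Xt] _]; apply: noT; exists t.
  have Bt n : (jump_time S n w <= t%:E)%E.
    elim: n => [|n IH]; first by rewrite jt0 lee_fin.
    rewrite leNgt; apply/negP => tn.
    by have := hSome t n w t0 IH tn; rewrite Xt.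
  exists (Num.truncn t).+1 => // n; apply: le_trans (Bt n) _.
  by rewrite lee_fin ltW// truncnS_gt.
have mB m : measurable (B m).
  have -> : B m = \bigcap_n [set w | (jump_time S n w <= m%:R%:E)%E].
    by apply/seteqP; split=> [w h n _|w h n]; [exact: h|exact: (h n I)].
  apply: bigcapT_measurable => n; rewrite -[Y in measurable Y]setTI.
  apply: measurable_lee => //; apply: emeasurable_sum => i _; exact: mS.
have Y0 : P x [set w | Y 0%N w = x] = 1%E.
  have := law x 0%N (fun=> x) (fun=> 0) (fun=> lexx _).
  rewrite eqxx big_ord0 big_ord1 mulr0 oppr0 expR0 !mulr1 => <-.
  congr (P x _); apply/seteqP; split=> w /=.
    by move=> Yx [|//] _; split.
  by move=> /(_ 0%N (leqnn _)) [].
have mY0 : measurable [set w | Y 0%N w = x].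
  by rewrite -[X in measurable X]setTI; exact: (mY 0%N _ [set x]).
have PB m : P x (B m) = 0%E.
  pose E := expR (- (q * m%:R)).
  have Bbound n : (E%:E * P x (B m `&` [set w | Y 0%N w = x]) <= jump_laplace R Q q n x)%E.
    rewrite -(laplace_start R d T Q P Y S q hq rate_ge0 jump_ge0 mY mS S0 law).
    have mI : measurable (B m `&` [set w | Y 0%N w = x]) by exact: measurableI.
    rewrite -[B m `&` _]setIT -(integral_indic (P x) measurableT)//.
    rewrite -ge0_integralZl//; last 2 first.
    - by apply/measurable_EFinP; exact: measurable_indic.
    - by rewrite lee_fin expR_ge0.
    apply: ge0_le_integral => //.
    - by move=> w _; rewrite -EFinM lee_fin mulr_ge0// expR_ge0.
    - by apply/measurable_EFinP; apply: measurable_funM => //; exact: measurable_indic.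
    - apply/measurable_EFinP; apply: measurable_funM.
        exact: (measurable_visit R d T Y mY).
      exact: (measurable_total_discount R d T S q mS).
    move=> w _; rewrite -EFinM lee_fin indicE.
    have /andP[D0 _] := total_discount_bounds R d T S q hq S0 n w.
    case: (boolP (w \in _)) => [|_]; last by rewrite mulr0 mulr_ge0.
    rewrite inE => -[Bw Yx]; rewrite mulr1 Yx eqxx mul1r.
    by apply: expR_le_discount => //; exact: Bw.
  have E0 : 0 < E by exact: expR_gt0.
  have PBY : P x (B m `&` [set w | Y 0%N w = x]) = 0%E.
    apply/eqP; rewrite eq_le measure_ge0 andbT; apply/lee_addgt0Pr => e e0.
    rewrite add0e; have [n hn] := hL x (E * e) x0 (mulr_gt0 E0 e0).
    have := le_trans (Bbound n) hn; by rewrite EFinM lee_pmul2l.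
  have PNY : P x (~` [set w | Y 0%N w = x]) = 0%E.
    by rewrite probability_setC// Y0 subee.
  have -> : B m = (B m `&` [set w | Y 0%N w = x]) `|` (B m `&` ~` [set w | Y 0%N w = x]).
    by rewrite -setIUr setUv setIT.
  have mBY : measurable (B m `&` [set w | Y 0%N w = x]) by exact: measurableI.
  have mNY : measurable (~` [set w | Y 0%N w = x]) by exact: measurableC.
  have mBN : measurable (B m `&` ~` [set w | Y 0%N w = x]) by exact: measurableI.
  have BN0 : P x (B m `&` ~` [set w | Y 0%N w = x]) = 0%E.
    by apply: (subset_measure0 mBN mNY) => //; exact: subIsetr.
  by rewrite measureU0.
rewrite lifeE ltNge => /negP; apply.
apply: le_trans (generalized_Boole_inequality _ _ _) _ => //.
  exact: bigcupT_measurable.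
by rewrite eseries0// => m _ _; exact: PB.
Qed.
End NonExplosion.

(** * Comparison with superharmonic functions *)

Section Comparison.
Variables (R : realType) (lambda mu : R) (p : nat -> R) (r : int -> R) (q : R).
Hypotheses (hlambda : 0 < lambda) (hmu : 0 <= mu).
Hypotheses (hp : offspring_law p) (hr : immigration_law r) (hq : 0 < q).
Local Notation Q := (generator lambda mu p r).
Local Notation H := (jump_op R lambda mu p r).

Let p_ge0 : forall k, 0 <= p k. Proof. by case: hp. Qed.
Let p_sum : series p @ \oo --> (1 : R). Proof. by case: hp. Qed.
Let r_ge0 k : 0 <= r k. Proof. by case: hr. Qed.
Let r_sum := immigration_sum _ _ hr.

Lemma rate_generator x : (0 < x)%N -> rate Q x = lambda * x%:R + mu.
Proof. by move=> x0; rewrite /rate /generator gtn_eqF// eqxx opprK. Qed.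

Lemma rate_generator0 : rate Q 0 = 0.
Proof. by rewrite /rate /generator eqxx oppr0. Qed.

Lemma rate_generator_gt0 x : (0 < x)%N -> 0 < lambda * x%:R + mu.
Proof. by move=> x0; rewrite ltr_pwDl// mulr_gt0// ltr0n. Qed.

Lemma rate_generator_ge0 x : 0 <= rate Q x.
Proof.
case: x => [|x]; first by rewrite rate_generator0.
by rewrite rate_generator// ltW// rate_generator_gt0.
Qed.

Lemma jump_matrix_generator n k : jump_matrix Q n.+1 (n + k)%N =
  (p k * (lambda * n.+1%:R) + r (k%:Z - 1) * mu) / (lambda * n.+1%:R + mu).
Proof.
rewrite /jump_matrix rate_generator// gt_eqF ?rate_generator_gt0//.
have [_ _ _ p1] := hp; have [_ _ r0 _] := hr.
case: eqP => [nk|/eqP nk].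
  have -> : k = 1%N by move/eqP: nk; rewrite -addn1 eqn_add2l => /eqP.
  by rewrite p1 subrr r0 !mul0r addr0 mul0r.
rewrite /generator /= eq_sym (negbTE nk) ltnS leq_addr subSS addKn.
suff -> : (n + k)%N%:Z - n.+1%:Z = k%:Z - 1 :> int by [].
by rewrite -addn1 !PoszD; ring.
Qed.

Lemma jump_matrix_generator_lt n j : (j < n)%N -> jump_matrix Q n.+1 j = 0.
Proof.
move=> jn; rewrite /jump_matrix rate_generator// gt_eqF ?rate_generator_gt0//.
have jE : (j == n.+1) = false by rewrite ltn_eqF// ltnW.
by rewrite eq_sym jE /generator /= jE ltnS leqNgt jn /= mul0r.
Qed.

Lemma jump_matrix_generator_ge0 i j : 0 <= jump_matrix Q i j.
Proof.
case: i => [|n]; first by rewrite /jump_matrix rate_generator0 eqxx ler0n.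
have [jn|nj] := ltnP j n; first by rewrite jump_matrix_generator_lt.
rewrite -(subnKC nj) jump_matrix_generator divr_ge0//.
  by rewrite addr_ge0// !mulr_ge0// ?ltW.
by rewrite ltW// rate_generator_gt0.
Qed.

(** The jump from [x] to [x - 1 + k] collects the birth of [k] particles and the
    immigration of [k - 1]; the excluded diagonal [k = 1] contributes nothing to the
    right-hand side as [p 1 = r 0 = 0]. *)
Lemma sum_jump_matrix (f : nat -> R) (M : R) x : (0 < x)%N -> (forall k, 0 <= f k <= M) ->
  (\sum_(j <oo) (jump_matrix Q x j)%:E * (f j)%:E = (H f x / (lambda * x%:R + mu))%:E)%E.
Proof.
case: x => // n _ fM.
have f0 k : 0 <= f k by case/andP: (fM k).
have fn k : `|f k| <= M by rewrite ger0_norm//; case/andP: (fM k).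
set c := lambda * n.+1%:R + mu.
have t0 j : (0 <= (jump_matrix Q n.+1 j)%:E * (f j)%:E)%E.
  by rewrite mule_ge0 ?lee_fin ?jump_matrix_generator_ge0.
rewrite (nneseries_split 0 n)// big1_seq ?add0e; last first.
  by move=> j; rewrite mem_index_iota => /andP[_ jn]; rewrite jump_matrix_generator_lt ?mul0e.
rewrite add0n -(nneseries_addn n)//.
pose u k := (p k * (lambda * n.+1%:R) + r (k%:Z - 1) * mu) / c * f (n + k)%N.
under eq_eseriesr do rewrite addnC jump_matrix_generator -EFinM -/(u _).
have rc : series (fun k : nat => r (k%:Z - 1) * f (n + k)%N) @ \oo -->
    r (-1) * f n + limn (series (fun k : nat => r k%:Z * f (n.+1 + k)%N)).
  have h := cvg_series_bounded_mul R (fun k : nat => r k%:Z) (fun k => f (n.+1 + k)%N) _ M (fun=> r_ge0 _) r_sum (fun=> fn _).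
  rewrite -cvg_shiftS.
  rewrite (_ : (fun _ => _) = fun m : nat => r (-1) * f n +
      series (fun k : nat => r k%:Z * f (n.+1 + k)%N) m).
    by apply: cvgD => //; exact: cvg_cst.
  apply/funext => m; rewrite !seriesEnat/= big_nat_recl//= sub0r addn0; congr (_ + _).
  by apply: eq_bigr => i _; rewrite addSnnS; congr (r _ * _); rewrite -addn1 PoszD addrK.
have pc := cvg_series_bounded_mul R p (fun k => f (n + k)%N) _ M p_ge0 p_sum (fun=> fn _).
have uc : series u @ \oo --> H f n.+1 / c.
  rewrite (_ : series u = fun m => (lambda * n.+1%:R * series (fun k => p k * f (n + k)%N) m +
     mu * series (fun k : nat => r (k%:Z - 1) * f (n + k)%N) m) / c).
    have pE : (fun k => p k * f (n.+1 + k - 1)%N) = fun k => p k * f (n + k)%N.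
      by apply/funext => k; rewrite addSn subn1.
    rewrite /jump_op pE subn1; apply: cvgMr_tmp; apply: cvgD; apply: cvgMl_tmp => //.
  apply/funext => m; rewrite !seriesEnat/= !mulr_sumr -big_split/= mulr_suml.
  by apply: eq_bigr => k _; rewrite /u; ring.
apply/cvg_lim => //.
rewrite (_ : (fun _ => _) = EFin \o series u); last first.
  by apply/funext => m; rewrite /= seriesEnat/= sumEFin.
by apply: cvg_EFin => //; exact: nearW.
Qed.

Local Notation L := (jump_laplace R Q q).

Lemma jump_laplace_le1 n x : (L n x <= 1)%E.
Proof.
have k1 y : holding_laplace R Q q y <= 1.
  rewrite /holding_laplace ler_pdivrMr ?mul1r ?lerDr ?(ltW hq)//.
  by rewrite ltr_pwDl ?rate_generator_ge0.
have k0 y : 0 <= holding_laplace R Q q y by apply: holding_laplace_ge0 => //; exact: rate_generator_ge0.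
elim: n x => [|n IH] x /=; first by rewrite lee_fin.
case: x => [|x].
  by rewrite /holding_laplace rate_generator0 mul0r mul0e.
apply: (@le_trans _ _ (1 * 1)%E); last by rewrite mule1.
apply: lee_pmul; rewrite ?lee_fin//.
  apply: nneseries_ge0 => j _ _; rewrite mule_ge0 ?lee_fin ?jump_matrix_generator_ge0//.
  by apply: jump_laplace_ge0 => //; [exact: rate_generator_ge0|exact: jump_matrix_generator_ge0].
have -> : (1 = \sum_(j <oo) (jump_matrix Q x.+1 j)%:E * (1 : R)%:E)%E.
  rewrite (sum_jump_matrix (fun=> 1) 1)//; last by move=> k; rewrite ler01 lexx.
  by rewrite (jump_op_cst _ _ _ _ _ hp hr) mul1r divff// gt_eqF// rate_generator_gt0.
apply: lee_nneseries => j *.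
  rewrite mule_ge0 ?lee_fin ?jump_matrix_generator_ge0//.
  by apply: jump_laplace_ge0 => //; [exact: rate_generator_ge0|exact: jump_matrix_generator_ge0].
by apply: lee_wpmul2l; rewrite ?lee_fin ?jump_matrix_generator_ge0.
Qed.

(** Comparison principle: a nonnegative function with [Q F <= q F] tending to 1
    at infinity dominates the Laplace transforms of the jump times in the limit.
    Outside a finite set there is nothing to prove, and inside it the rates are
    bounded, so the defect shrinks by a constant factor at each jump. *)
Lemma jump_laplace_le (F : nat -> R) :
  (forall x, 0 <= F x <= 1) ->
  (forall x, (0 < x)%N -> H F x <= (q + lambda * x%:R + mu) * F x) ->
  F @ \oo --> (1 : R) ->
  forall x e, 0 < e -> exists n, (L n x <= (F x + e)%:E)%E.
Proof.
move=> F01 HF F1 x e e0; pose dl := e / 2.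
have dl0 : 0 < dl by rewrite divr_gt0.
(* [F + dl] is at least 1 beyond [N], and [th] bounds the Laplace transforms of the
   holding times before [N]. *)
have [N _ FN] : \forall x \near \oo, 1 - dl <= F x.
  by move/cvgr_ge : F1; apply; rewrite gtrBl.
pose a := lambda * N.+1%:R + mu.
have a0 : 0 < a by exact: rate_generator_gt0.
have qa : 0 < q + a by rewrite addr_gt0.
pose th := a / (q + a).
have th0 : 0 < th by rewrite divr_gt0.
have th1 : th < 1 by rewrite ltr_pdivrMr// mul1r ltrDr.
have F0 y : 0 <= F y by case/andP: (F01 y).
have bound n y : (L n y <= (F y + (dl + th ^+ n))%:E)%E.
  elim: n y => [|n IH] y.
    apply: le_trans (jump_laplace_le1 0 y) _.
    by rewrite expr0 lee_fin; have := F0 y; lra.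
  have thn0 m : 0 <= th ^+ m by rewrite exprn_ge0// ltW.
  have [Ny|yN] := leqP N y.
    apply: le_trans (jump_laplace_le1 n.+1 y) _; rewrite lee_fin.
    have := FN y Ny; have := thn0 n.+1; lra.
  case: y yN => [|y] yN.
    rewrite /= /holding_laplace rate_generator0 mul0r mul0e lee_fin.
    by rewrite !addr_ge0// ltW.
  pose c := dl + th ^+ n.
  have c0 : 0 <= c by rewrite addr_ge0// ltW.
  pose ry := lambda * y.+1%:R + mu.
  have ry0 : 0 < ry by exact: rate_generator_gt0.
  have qry : 0 < q + ry by rewrite addr_gt0.
  have Jle : (\sum_(j <oo) (jump_matrix Q y.+1 j)%:E * L n j <=
      ((H F y.+1 + c * ry) / ry)%:E)%E.
    have <- : H (fun j => c - -1 * F j) y.+1 = H F y.+1 + c * ry.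
      rewrite (jump_op_affine _ _ _ _ _ hp hr _ 1); first by rewrite mulN1r opprK addrC.
      by move=> k; rewrite ger0_norm//; case/andP: (F01 k).
    rewrite -(sum_jump_matrix _ (c + 1))//; last first.
      by move=> k; rewrite mulN1r opprK addr_ge0//= lerD2l; case/andP: (F01 k).
    apply: lee_nneseries => j *.
      rewrite mule_ge0 ?lee_fin ?jump_matrix_generator_ge0//.
      by apply: jump_laplace_ge0 => //; [exact: rate_generator_ge0|exact: jump_matrix_generator_ge0].
    rewrite lee_wpmul2l ?lee_fin ?jump_matrix_generator_ge0//.
    by rewrite mulN1r opprK addrC; exact: IH.
  rewrite /=; apply: le_trans (lee_wpmul2l _ Jle) _.
    by rewrite lee_fin holding_laplace_ge0//; exact: rate_generator_ge0.
  rewrite -EFinM lee_fin /holding_laplace rate_generator// -/ry.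
  have -> : ry / (q + ry) * ((H F y.+1 + c * ry) / ry) = (H F y.+1 + c * ry) / (q + ry).
    by field; rewrite !gt_eqF.
  have HFy : H F y.+1 <= (q + ry) * F y.+1.
    by have := HF y.+1 isT; rewrite addrA.
  rewrite ler_pdivrMr//.
  have rth : ry <= th * (q + ry).
    have rya : ry <= a.
      by rewrite lerD2r ler_wpM2l ?(ltW hlambda)// ler_nat (ltnW (ltn_trans yN (ltnSn N))).
    have ryaq : ry * q <= a * q by rewrite ler_wpM2r// ltW.
    rewrite /th mulrAC ler_pdivlMr//; move: (ry) (a) ryaq => u v h.
    by rewrite !mulrDr [u * v]mulrC lerD2r.
  have thry : th ^+ n * ry <= th ^+ n.+1 * (q + ry).
    by rewrite exprSr -mulrA ler_wpM2l.
  have dry : dl * ry <= dl * (q + ry).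
    by rewrite ler_wpM2l ?(ltW dl0)// lerDr ltW.
  rewrite /c; move: (th ^+ n) (th ^+ n.+1) (F y.+1) (ry) HFy thry dry => u v f s.
  by move: (H F y.+1) => h; lra.
have [n thn] : exists n, th ^+ n <= dl.
  have lim : th ^+ n @[n --> \oo] --> 0 by apply: cvg_expr; rewrite gtr0_norm.
  have [n _ h] : \forall n \near \oo, th ^+ n <= dl by move/cvgr_le : lim; apply.
  by exists n; exact: (h n (leqnn _)).
exists n; apply: le_trans (bound n x) _; rewrite lee_fin.
by have : dl + dl = e := esym (splitr e); lra.
Qed.

Lemma near_one_expr (c e : R) x : c < 1 -> 0 < e ->
  exists a, [/\ c < a, a < 1 & 1 - e <= a ^+ x].
Proof.
move=> c1 e0; have lim : a ^+ x @[a --> (1 : R)^'-] --> (1 : R).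
  rewrite -[X in _ --> X](expr1n _ x); apply: cvg_at_left_filter.
  exact: exprn_continuous.
near (1 : R)^'- => a; exists a; split.
- by near: a; exact: nbhs_left_gt.
- by near: a; exact: nbhs_left_lt.
- by near: a; move/cvgr_ge : lim; apply; rewrite gtrBl.
Unshelve. all: by end_near. Qed.

End Comparison.

(** * Explosion and the exponent at 1 *)

Section Explosion.
Variables (R : realType) (lambda mu : R) (p : nat -> R) (r : int -> R) (q : R).
Hypotheses (hlambda : 0 < lambda) (hmu : 0 <= mu).
Hypotheses (hp : offspring_law p) (hr : immigration_law r) (hq : 0 < q).
Local Notation leb := (@lebesgue_measure R).
Local Notation Q := (generator lambda mu p r).
Local Notation H := (jump_op R lambda mu p r).
Local Notation C := (immigration_rate R mu r q).
Local Notation rho := (rho lambda p).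
Local Notation gam := (gammaq lambda mu p r q).
Local Notation ph := (phi p).

Let p_ge0 : forall k, 0 <= p k. Proof. by case: hp. Qed.
Let p_sum : series p @ \oo --> (1 : R). Proof. by case: hp. Qed.
Let rn_ge0 (k : nat) : 0 <= r k%:Z. Proof. by case: hr. Qed.
Let r_sum := immigration_sum _ _ hr.

(** The condition [Q F <= q F], together with the normalisation at infinity that the
    comparison principle asks for. *)
Definition superharmonic (F : nat -> R) : Prop :=
  [/\ forall y, 0 <= F y <= 1,
      forall y, (0 < y)%N -> H F y <= (q + lambda * y%:R + mu) * F y
    & F @ \oo --> (1 : R)].

Lemma resolvent_expr (v : R) y : 0 < v < 1 -> (0 < y)%N ->
  (q + lambda * y%:R + mu) * v ^+ y - H (fun k => v ^+ k) y =
  C v * v ^+ y - lambda * (ptilde p v - v) * (y%:R * v ^+ y.-1).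
Proof.
move=> /andP[v0 v1]; case: y => // n _.
have v01 : 0 <= v <= 1 by rewrite !ltW.
have lim (c : nat -> R) (S : R) m : (forall k, 0 <= c k) -> series c @ \oo --> S ->
    limn (series (fun k => c k * v ^+ (m + k))) = v ^+ m * ptilde c v.
  move=> c0 cS; apply/cvg_lim => //.
  rewrite (_ : series _ = fun n => v ^+ m * series (fun k => c k * v ^+ k) n).
    by apply: cvgMl_tmp; exact: (cvg_ptilde _ _ _ c0 cS _ v01).
  apply/funext => k; rewrite !seriesEnat/= mulr_sumr.
  by apply: eq_bigr => i _; rewrite exprD; ring.
rewrite /jump_op.
have -> : (fun k => p k * v ^+ (n.+1 + k - 1)) = fun k => p k * v ^+ (n + k).
  by apply/funext => k; rewrite addSn subn1.
rewrite (lim p 1 n)// (lim (fun k : nat => r k%:Z) _ n.+1 rn_ge0 r_sum) subn1 /=.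
rewrite /immigration_rate.
have -> : rtilde r v = r (-1) / v + ptilde (fun k : nat => r k%:Z) v by [].
move: (ptilde p v) (ptilde _ v) => A B; rewrite exprS.
by field; rewrite gt_eqF.
Qed.

Lemma resolvent_one_sub (f : nat -> R) (M c : R) y : (forall k, `|f k| <= M) ->
  (q + lambda * y%:R + mu) * (1 - c * f y) - H (fun k => 1 - c * f k) y =
  q - c * ((q + lambda * y%:R + mu) * f y - H f y).
Proof. by move=> fM; rewrite (jump_op_affine _ _ _ _ _ hp hr _ M)//; ring. Qed.

(** The solution of [2 eta (1 + 1 / q) = e], a distance between [C] and [q] at which the
    superharmonic functions constructed from it are at most [e]. *)
Let eta (e : R) := e * q / (2 + 2 * q).

Let eta_spec (e : R) : 0 < e < 1 ->
  [/\ 0 < eta e, eta e < q, eta e < 1,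
    1 - e <= q / (q + eta e) * (1 - eta e)
    & 1 - e <= (q - eta e) / (q + eta e) * (1 - eta e) * (1 - eta e)].
Proof.
move=> /andP[e0 e1].
have q2 : 0 < 2 + 2 * q by rewrite addr_gt0// mulr_gt0.
have E : eta e * (2 + 2 * q) = e * q by rewrite /eta divfK// gt_eqF.
have n0 : 0 < eta e by rewrite divr_gt0// mulr_gt0.
have eq : e * q < q by rewrite gtr_pMl.
move: (eta e) E n0 => n E n0.
have nq0 : 0 < n * q by rewrite mulr_gt0.
have nq : n < q by lra.
have n1 : n < 1 by rewrite -(ltr_pM2r hq) mul1r; lra.
have qn : 0 < q + n by rewrite addr_gt0.
split=> //.
  by rewrite mulrAC ler_pdivlMr//; nra.
have -> : (q - n) / (q + n) * (1 - n) * (1 - n) = (q - n) * ((1 - n) * (1 - n)) / (q + n).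
  by ring.
rewrite ler_pdivlMr//.
have h1 : 1 - 2 * n <= (1 - n) * (1 - n) by nra.
have qmn : 0 <= q - n by rewrite subr_ge0 ltW.
have := ler_wpM2l qmn h1; nra.
Qed.

(** When [phi = 1], [ptilde - id] is nonnegative, so [(q - Q) (1 - s v^x)] is at least
    [q - s C(v)] where [C(v) >= 0]; with [v] near 1 this allows [s] near 1. *)
Lemma small_superharmonic_phi1 (x : nat) (e : R) : ph = 1 -> 0 < e < 1 ->
  exists2 F, superharmonic F & F x <= e.
Proof.
move=> ph1 e01; have [n0 nq n1 hE _] := eta_spec _ e01.
have [c /andP[c0 c1] hC] := immigration_rate_near1 _ mu _ q hr _ n0.
have [v [cv v1 vx]] := near_one_expr _ c (eta e) x c1 n0.
have v01 : 0 < v < 1 by rewrite (lt_trans c0 cv).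
have /andP[v0 _] := v01.
have qn : 0 < q + eta e by rewrite addr_gt0.
pose s := q / (q + eta e).
have s0 : 0 < s by rewrite divr_gt0.
have s1 : s <= 1 by rewrite ler_pdivrMr// mul1r lerDl ltW.
have ve k : 0 <= v ^+ k <= 1 by rewrite exprn_ge0 ?exprn_ile1 ?ltW.
have vb k : `|v ^+ k| <= 1 by have /andP[? ?] := ve k; rewrite ger0_norm.
exists (fun k => 1 - s * v ^+ k); last first.
  have := ler_wpM2l (ltW s0) vx; move: hE; rewrite -/s; lra.
split.
- move=> y; have /andP[y0 y1] := ve y.
  rewrite subr_ge0 gerBl mulr_ge0 ?(ltW s0)// andbT.
  by rewrite mulr_ile1 ?(ltW s0).
- move=> y y0; rewrite -subr_ge0 (resolvent_one_sub _ 1)// resolvent_expr//.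
  have A0 : 0 <= lambda * (ptilde p v - v) * (y%:R * v ^+ y.-1).
    have := ptilde_gt_id _ _ hp v; rewrite ph1 => /(_ v01) A.
    by rewrite !mulr_ge0 ?ler0n ?exprn_ge0 ?(ltW v0) ?(ltW A) ?(ltW hlambda).
  have Cv : C v <= q + eta e.
    have := hC v; rewrite (ltW cv) v1 => /(_ isT); rewrite ltr_norml => /andP[_].
    by lra.
  have Cvy : C v * v ^+ y <= q + eta e.
    have /andP[y0' y1] := ve y; apply: le_trans (ler_wpM2r y0' Cv) _.
    by rewrite ler_piMr// ltW.
  have sq : s * (q + eta e) = q by rewrite /s divfK// gt_eqF.
  rewrite subr_ge0 -[leRHS]sq ler_wpM2l ?(ltW s0)//; lra.
- rewrite -[X in _ --> X](subr0 1) -(mulr0 s); apply: cvgB; first exact: cvg_cst.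
  by apply: cvgMl_tmp; apply: cvg_expr; rewrite gtr0_norm.
Qed.

(** In the supercritical case with [int^1 gammaq = oo], the mixture of the [v^x],
    [a < v < b], with weights [e / rho], where [e' = gammaq e] and [e b = 1],
    has mass close to [1 / q] when [a] is near 1 and [G b - G a] is large; so [q] times
    the mixture is close to 1 at a given point, while it vanishes at infinity. *)
Lemma small_superharmonic_unbounded (G : R -> R) (x : nat) (e : R) :
  phiq mu r q < ph -> ph < 1 -> primitive_oo R ph 1 G gam ->
  (forall M, exists2 v, ph < v < 1 & M < G v) ->
  0 < e < 1 -> exists2 F, superharmonic F & F x <= e.
Proof.
move=> zph ph1 dG Gunb e01; have [n0 nq n1 _ hE] := eta_spec _ e01.
have [ph0 _ _ _] := phi_spec _ _ hp.
have [c /andP[c0 c1] hC] := immigration_rate_near1 _ mu _ q hr _ n0.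
have mc1 : Num.max c ph < 1 by rewrite gt_max c1 ph1.
have [a [ma a1 ax]] := near_one_expr _ _ (eta e) x mc1 n0.
move: ma; rewrite gt_max => /andP[ca pa].
have Cb v : a <= v < 1 -> q - eta e <= C v <= q + eta e.
  move=> /andP[av v1]; have := hC v; rewrite (le_trans (ltW ca) av) v1 => /(_ isT).
  by rewrite ltr_norml => /andP[? ?]; apply/andP; split; lra.
have qmn : 0 < q - eta e by rewrite subr_gt0.
have qpn : 0 < q + eta e by rewrite addr_gt0.
have in01 v : ph < v < 1 -> 0 < v < 1 by move=> /andP[pv ->]; rewrite (lt_trans ph0).
have nph v : ph < v < 1 -> v != ph by move=> /andP[pv _]; rewrite gt_eqF.
have mono u v : ph < u -> u <= v -> v < 1 -> G u <= G v.
  move=> pu uv v1; apply: (primitive_oo_le _ _ _ _ _ _ _ dG) => // w pw.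
  apply/ltW/(gammaq_gt0 _ _ _ _ _ _ hlambda hmu hp hr hq); last exact: nph.
  by case/andP: pw => pw ->; rewrite (lt_trans zph).
have [b /andP[pb b1]] := Gunb (Num.max (G a) (G a - ln (eta e))).
rewrite gt_max => /andP[Gab Gb].
have ab : a < b by rewrite ltNge; apply/negP => /mono; rewrite leNgt Gab => /(_ pb a1).
pose k v := expR (G v - G b).
have ka : k a <= eta e.
  by rewrite -[leRHS]lnK ?posrE// ler_expR; lra.
have ka0 : 0 <= k a by exact: expR_ge0.
have dk0 : primitive_oo R ph 1 k (fun v => - (-1 * (gam v * k v))).
  move=> v vab; have dGl := primitive_oo_addC _ _ _ (G b) _ _ dG v vab.
  have := @is_derive1_comp R (@expR R) (fun v => G v - G b) v _ _ (is_derive_expR _) dGl.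
  by rewrite mulN1r opprK mulrC.
have dk : primitive_oo R a b k (fun v => - (-1 * (gam v * k v))).
  by apply: primitive_oo_sub dk0; exact: ltW.
have kc v : ph < v < 1 -> k w @[w --> v] --> k v by exact: (primitive_oo_continuous _ _ _ _ _ dk0).
have kac : k v @[v --> a^'+] --> k a by apply: cvg_at_right_filter; apply: kc; rewrite pa a1.
have kbc : k v @[v --> b^'-] --> (1 : R).
  have E : k b = 1 by rewrite /k subrr expR0.
  by rewrite -[X in _ --> X]E; apply: cvg_at_left_filter; apply: kc; rewrite pb b1.
have sub v : a < v < b -> ph < v < 1.
  by move=> /andP[av vb]; rewrite (lt_trans pa av) (lt_trans vb b1).
have a0 : 0 <= a by rewrite ltW// (lt_trans ph0).
have ss : -1 * -1 = 1 :> R by rewrite mulrNN mulr1.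
have nphab v : a < v < b -> v != ph by move=> /sub/nph.
have k0 v : a < v < b -> 0 <= k v by move=> _; exact: expR_ge0.
have Clo v : a < v < b -> q - eta e <= C v.
  by move=> /andP[av vb]; have := Cb v; rewrite (ltW av) (lt_trans vb b1) => /(_ isT)/andP[].
have Chi v : a < v < b -> C v <= q + eta e.
  by move=> /andP[av vb]; have := Cb v; rewrite (ltW av) (lt_trans vb b1) => /(_ isT)/andP[].
have iK := kernel_integrable _ _ mu _ _ q hlambda hp hr _ _ _ _ _ _ _
  a0 ab (ltW b1) ss nphab k0 dk kac kbc qmn Clo.
have mle := kernel_mass_le _ _ mu _ _ q hlambda hp hr _ _ _ _ _ _ _
  a0 ab (ltW b1) ss nphab k0 dk kac kbc qmn Clo.
have mge := kernel_mass_ge _ _ mu _ _ q hlambda hp hr _ _ _ _ _ _ _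
  a0 ab (ltW b1) ss nphab k0 dk kac kbc qmn Clo _ Chi.
have mx := moment_ge_expr _ _ mu _ _ q hlambda hp hr _ _ _ _ _ _ _
  a0 ab (ltW b1) ss nphab k0 dk kac kbc qmn Clo.
pose f := moment R `]a, b[ (fun v => k v / rho v).
rewrite -/f in mle mge mx; rewrite mulN1r opprK in mle mge.
have mab : @measurable _ (measurableTypeR R) `]a, b[%classic by exact: measurable_itv.
have D01 v : `]a, b[%classic v -> 0 < v < 1 by rewrite /= in_itv/= => /sub/in01.
have K0 v : `]a, b[%classic v -> 0 <= k v / rho v.
  rewrite /= in_itv/= => vab; rewrite divr_ge0 ?k0//.
  by rewrite ltW// (rho_gt0 _ _ _ hlambda hp) ?nphab//; exact/in01/sub.
have f0 y : 0 <= f y by exact: (moment_ge0 _ _ _ D01 K0).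
have fle y : f y <= f 0%N by exact: (moment_le _ _ _ mab D01 K0 iK).
have flim : f @ \oo --> 0 by exact: (moment_cvg0 _ _ _ mab D01 K0 iK).
have fb y : `|f y| <= f 0%N by rewrite ger0_norm.
exists (fun y => 1 - (q - eta e) * f y); last first.
  have h1 : (1 - eta e) / (q + eta e) <= f 0%N.
    by rewrite ler_pdivrMr// mulrC; lra.
  have h2 : (1 - eta e) * ((1 - eta e) / (q + eta e)) <= f x.
    apply: le_trans (mx x); apply: ler_pM => //; first by rewrite subr_ge0 ltW.
    by rewrite divr_ge0 ?subr_ge0 ?ltW.
  have h3 := ler_wpM2l (ltW qmn) h2.
  have E : (q - eta e) / (q + eta e) * (1 - eta e) * (1 - eta e) =
    (q - eta e) * ((1 - eta e) * ((1 - eta e) / (q + eta e))) by ring.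
  by move: hE; rewrite E; lra.
split.
- move=> y; rewrite gerBl mulr_ge0 ?(ltW qmn)// andbT subr_ge0.
  apply: le_trans (ler_wpM2l (ltW qmn) (fle y)) _.
  by apply: le_trans mle _; lra.
- move=> y y0; rewrite -subr_ge0 (resolvent_one_sub _ (f 0%N))//.
  rewrite (resolvent_kernel _ _ _ _ _ _ hlambda hp hr a b (-1) k y (k a * a ^+ y) (1 * b ^+ y))//; first last.
  + by apply: cvgM => //; apply: cvg_at_left_filter; exact: exprn_continuous.
  + by apply: cvgM => //; apply: cvg_at_right_filter; exact: exprn_continuous.
  + by move=> v /sub vab; rewrite mulN1r (rho_gt_phi _ _ _ hp)// opprK.
  + exact: ltW.
  rewrite mulN1r opprK mul1r subr_ge0.
  have by1 : b ^+ y <= 1 by rewrite exprn_ile1 ?ltW// (lt_trans ph0).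
  have : b ^+ y - k a * a ^+ y <= 1.
    by have : 0 <= k a * a ^+ y by [rewrite mulr_ge0// exprn_ge0]; lra.
  by move=> /(ler_wpM2l (ltW qmn)); rewrite mulr1; lra.
- rewrite -[X in _ --> X](subr0 1) -(mulr0 (q - eta e)); apply: cvgB; first exact: cvg_cst.
  exact: cvgMl_tmp.
Qed.

(** Explosion requires the branching mechanism to be supercritical and the exponent
    of the kernel at 1 to be finite: otherwise the explosion time has Laplace
    transform 0. *)
Lemma explosive_exponent d (T : measurableType d) (P : nat -> probability T R)
    (X : R -> T -> option nat) :
  minimal_ctmc Q P X -> phiq mu r q < ph -> explosive P X ->
  ph < 1 /\ exists G M, primitive_oo R ph 1 G gam /\ forall v, ph < v < 1 -> G v <= M.
Proof.
move=> hX zph; apply: contraPP => nE.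
apply: (not_explosive_laplace _ _ _ _ _ _ q hq (rate_generator_ge0 _ _ _ _ _ hlambda hmu)
  (jump_matrix_generator_ge0 _ _ _ _ _ hlambda hmu hp hr) hX).
move=> x e0 x0 e0_gt0.
suff small e : 0 < e < 1 -> exists2 F, superharmonic F & F x <= e.
  pose e := Num.min (e0 / 2) (1 / 2).
  have [e_gt0 e1 ee] : [/\ 0 < e, e < 1 & e <= e0 / 2].
    by rewrite /e; case: (lerP (e0 / 2) (1 / 2)) => ?; split; lra.
  have [|F [F01 HF F1] Fx] := small e; first by rewrite e_gt0.
  have [n hn] := jump_laplace_le _ _ _ _ _ _ hlambda hmu hp hr hq F F01 HF F1 x e e_gt0.
  by exists n; apply: le_trans hn _; rewrite lee_fin; lra.
move=> e01; have [ph0 ph1 _ _] := phi_spec _ _ hp.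
move: ph1; rewrite le_eqVlt => /predU1P[ph1|ph1]; first exact: small_superharmonic_phi1.
have cgam : continuous_oo R ph 1 gam.
  move=> v /andP[pv v1]; apply: (gammaq_continuous _ _ _ _ _ _ hlambda hp hr).
    by rewrite v1 (lt_trans ph0).
  by rewrite gt_eqF.
have [G dG] := primitive_ex _ _ _ _ ph1 cgam.
apply: (small_superharmonic_unbounded G) => // M.
apply: contrapT => noM; apply: nE; split=> //; exists G, M; split=> // v vab.
by rewrite leNgt; apply/negP => Mv; apply: noM; exists v.
Qed.
End Explosion.

(** * The harmonic functions *)

Theorem theorem3p6 (R : realType) (lambda mu : R) (p : nat -> R) (r : int -> R)
    (d : measure_display) (T : measurableType d) (P : nat -> probability T R)
    (X : R -> T -> option nat) (q : R)
    (hlambda : 0 < lambda) (hmu : 0 <= mu)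
    (hp : offspring_law p) (hr : immigration_law r)
    (hup : (exists k : nat, (0 < k)%N /\ 0 < mu * r k%:Z) \/ p 0%N < 1)
    (hX : minimal_ctmc (generator lambda mu p r) P X)
    (hq : 0 < q) :
  let E := explosive P X in
  let phi := phi p in
  let phiq := phiq mu r q in
  let gammaq := gammaq lambda mu p r q in
  let Phiq := Phiq lambda mu p r q in
  let Psiq := Psiq lambda mu p r q in
  let Iq := Iq E lambda mu p r q in
  let Iq0 := Iq0 E lambda mu p r q in
  (* signs of ptilde - id and of gammaq *)
  [/\ forall z, 0 < z < phi -> 0 < ptilde p z - z,
      forall z, phi < z < 1 -> ptilde p z - z < 0,
      forall z, 0 < z < phiq -> z != phi -> gammaq z < 0
    & forall z, phiq < z < 1 -> z != phi -> 0 < gammaq z] /\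
  (* (i) *)
  (phiq < phi ->
     [/\ forall x, (0 < Phiq x < +oo)%E,
         (Iq0 `\ (fun=> 0)) (fun x => fine (Phiq x))
       & E -> (forall x, Psiq x \is a fin_num) /\
              (Iq `\` Iq0) (fun x => fine (Psiq x))]) /\
  (* (ii) *)
  (phiq = phi ->
     (forall x : nat, 0 < phi ^+ x) /\
     (Iq0 `\ (fun=> 0)) (fun x : nat => phi ^+ x)).
Proof.
move=> E ph zq gam Phi Psi I I0.
have [ph0 ph1 Pph _] := phi_spec _ _ hp.
have /andP[zq0 zq1] := phiq_bounds _ _ _ _ hmu hr hq.
split; [split|split].
- exact: ptilde_gt_id.
- exact: ptilde_lt_id.
- move=> z; exact: gammaq_lt0.
- move=> z; exact: gammaq_gt0.
- move=> zph.
  have [e [e1 de elim iK PhiE]] := PhiqE _ _ _ _ _ _ hlambda hmu hp hr hq zph.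
  set f := moment R `]0, phi p[ (fun v => e v / rho lambda p v) in PhiE.
  have mab : @measurable _ (measurableTypeR R) `]0, phi p[%classic by exact: measurable_itv.
  have D01 v : `]0, phi p[%classic v -> 0 < v < 1.
    by rewrite /= in_itv/= => /andP[-> vp]; rewrite (lt_le_trans vp).
  have Kpos v : 0 < v < phi p -> 0 < e v / rho lambda p v.
    move=> vab; have /andP[ev _] := e1 v vab; rewrite divr_gt0//.
    apply: (rho_gt0 _ _ _ hlambda hp); first by apply: D01; rewrite /= in_itv.
    by case/andP: vab => _ vp; rewrite lt_eqF.
  have K0 v : `]0, phi p[%classic v -> 0 <= e v / rho lambda p v.
    by rewrite /= in_itv/= => /Kpos/ltW.
  have f_gt0 x : 0 < f x.
    apply: Rintegral_itvoo_gt0 => //.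
      exact: (integrable_moment _ _ _ mab D01 iK).
    by move=> v vab; rewrite mulr_gt0 ?Kpos// exprn_gt0//; case/andP: vab.
  have fle x : f x <= f 0%N by exact: (moment_le _ _ _ mab D01 K0 iK).
  have flim : f @ \oo --> 0 by exact: (moment_cvg0 _ _ _ mab D01 K0 iK).
  have fineE : (fun x => fine (Phi x)) = fun x => q * f x.
    by apply/funext => x; rewrite /Phi PhiE.
  have limq : (fun x => q * f x) @ \oo --> (0 : R).
    by rewrite -(mulr0 q); apply: cvgMl_tmp.
  have fb y : `|f y| <= f 0%N by rewrite ger0_norm// ltW.
  split.
  + by move=> x; rewrite /Phi PhiE lte_fin ltry andbT mulr_gt0.
  + rewrite fineE; split; last first.
      by move=> /(congr1 (fun g => g 0%N)) /eqP; rewrite gt_eqF// mulr_gt0.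
    split=> //; split.
    * by exists (q * f 0%N) => x; rewrite normrM gtr0_norm// ler_wpM2l// ltW.
    * by move=> _; apply/cvg_ex; exists 0.
    * move=> x x0.
      have h := Phiq_resolvent _ _ _ _ _ _ hlambda hp hr e x x0 e1 de elim iK.
      (* [jump_op_affine] with [a = 0] and [b = - q] gives homogeneity. *)
      have qfE : (fun y => 0 - (- q) * f y) = (fun y => q * f y).
        by apply/funext => y; rewrite mulNr opprK add0r.
      have := jump_op_affine _ lambda mu p r hp hr f (f 0%N) 0 (- q) x fb.
      rewrite qfE mul0r add0r mulNr opprK -[in RHS]h => qH.
      by transitivity (q * ((q + lambda * x%:R + mu) * f x)); [ring|rewrite -qH].
  + move=> hE.
    have [phl [G [M [dG GM]]]] := explosive_exponent _ _ _ _ _ _ hlambda hmu hp hr hq _ _ _ _ hX zph hE.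
    have [g [g01 glim PsiE gres]] := Psiq_resolvent _ _ _ _ _ _ hlambda hmu hp hr hq zph phl _ _ dG GM.
    have finePsi : (fun x => fine (Psi x)) = fun x => 1 - q * g x.
      by apply/funext => x; rewrite /Psi PsiE.
    have limPsi : (fun x => 1 - q * g x) @ \oo --> (1 : R).
      rewrite -[X in _ --> X](subr0 1) -(mulr0 q); apply: cvgB; first exact: cvg_cst.
      exact: cvgMl_tmp.
    have gb y : `|g y| <= g 0%N by have /andP[? ?] := g01 y; rewrite ger0_norm.
    split; first by move=> x; rewrite /Psi PsiE.
    rewrite finePsi; split; last first.
      move=> [_ lim0].
      have e10 : (1 : R) = 0.
        by rewrite -(cvg_lim (@Rhausdorff R) limPsi) -(cvg_lim (@Rhausdorff R) lim0).
      by move/eqP : e10; rewrite oner_eq0.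
    split.
    * exists (1 + q * g 0%N) => x; have /andP[g0 g1] := g01 x.
      rewrite (le_trans (ler_normB _ _))// normr1 lerD2l normrM !ger0_norm ?(ltW hq)//.
      by rewrite ler_wpM2l// ltW.
    * by move=> _; apply/cvg_ex; exists 1.
    * move=> x x0; apply/eqP; rewrite -subr_eq0; apply/eqP.
      have := resolvent_one_sub _ lambda mu p r q hp hr g (g 0%N) q x gb.
      by rewrite gres// mulr1 subrr.
- move=> zph; have zph' : phiq mu r q = phi p by exact: zph.
  split; first by move=> x; rewrite exprn_gt0.
  have phl : phi p < 1 by rewrite -zph'.
  have mr : 0 < mu * r (-1).
    by move: ph0; rewrite -zph' /phiq; case: ifP => //; rewrite ltxx.
  (* At [v = phi = phiq] both coefficients in [resolvent_expr] vanish. *)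
  have [_ Cph] := phiq_spec _ _ _ _ hmu hr hq mr; rewrite zph' in Cph.
  have lim : (fun x : nat => phi p ^+ x) @ \oo --> (0 : R).
    by apply: cvg_expr; rewrite gtr0_norm.
  split; last first.
    by move=> /(congr1 (fun g => g 0%N)) /eqP; rewrite expr0 oner_eq0.
  split=> //; split.
  + exists 1 => x; rewrite ger0_norm ?exprn_ge0 ?(ltW ph0)//.
    by rewrite exprn_ile1 // ltW.
  + by move=> _; apply/cvg_ex; exists 0.
  + move=> x x0; apply/eqP; rewrite -subr_eq0; apply/eqP.
    have phl01 : 0 < phi p < 1 by rewrite ph0.
    have := resolvent_expr _ lambda mu p r q hp hr (phi p) x phl01 x0.
    by rewrite Cph Pph subrr mulr0 !mul0r subrr.
Qed.
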